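(* Let $Y$, $x$, $T$ be as in the context, with $Y$ not isomorphic to $O_{D+1}$ or $\Box_{2D+1}$, and let $q,s,h,h^*\in\mathbb{C}$ with $q,h,h^*$ nonzero satisfy $\theta_i=\theta_0+h(1-q^i)(1-sq^{i+1})q^{-i}$ and $\theta^*_i=\theta^*_0+h^*(1-q^i)(1-q^{-2D-1+i})q^{-i}$ for $0\le i\le D$. Let $W$ be an irreducible $T$-module with endpoint $r$, dual endpoint $t$ and diameter $d$. Then $c^*_0(W)=0$; $c^*_i(W)=\dfrac{h^*(1-q^{2i})(1-s^2q^{2+2d+4t+2i})}{q^{D+d+1}(1-sq^{2i+2t})(1-sq^{1+2i+2t})}$ for $1\le i\le d-1$; $c^*_d(W)=\dfrac{h^*(1-q^{2d})(1+sq^{2t+2d+1})}{q^{D+d+1}(1-sq^{2t+2d})}$; $b^*_0(W)=\dfrac{h^*(q^{2d}-1)(1+sq^{2t+1})}{q^{D+d}(1-sq^{2+2t})}$; $b^*_i(W)=\dfrac{h^*(q^{2d-2i}-1)(1-s^2q^{2+2i+4t})}{q^{D+d-2i}(1-sq^{2+2i+2t})(1-sq^{1+2i+2t})}$ for $1\le i\le d-1$; $b^*_d(W)=0$; $a^*_i(W)=\theta^*_r-b^*_i(W)-c^*_i(W)$ for $0\le i\le d$.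
   Context: $Y=(X,\{R_i\}_{0\le i\le D})$ is a symmetric association scheme ($X$ finite; $R_i$ partition $X\times X$, $R_0$ diagonal, $R_i$ symmetric; $p^h_{ij}=|\{z:(x,z)\in R_i,(z,y)\in R_j\}|$ for $(x,y)\in R_h$ independent of $x,y$), with $D\ge3$, associate matrices $A_i$, Bose–Mesner algebra $M=\mathrm{span}\{A_i\}$ with primitive idempotents $E_0,\dots,E_D$, Krein parameters $q^h_{ij}$ ($E_i\circ E_j=|X|^{-1}\sum_hq^h_{ij}E_h$). $Y$ is P-polynomial w.r.t. $R_0,\dots,R_D$ ($p^h_{ij}=0$ if one of $h,i,j$ exceeds the sum of the other two, $\ne0$ if it equals that sum), almost-bipartite ($p^i_{1i}=0$ for $0\le i\le D-1$, $p^D_{1D}\ne0$), and Q-polynomial w.r.t. $E_0,\dots,E_D$ (same conditions for $q^h_{ij}$). $A=A_1$, $AE_i=\theta_iE_i$. Fix $x\in X$: $E^*_i$ diagonal with $(E^*_i)_{yy}=1$ iff $(x,y)\in R_i$; $A^*$ diagonal with $(A^* )_{yy}=|X|(E_1)_{xy}$; $A^*E^*_i=\theta^*_iE^*_i$; $E_i=0$ for $i\notin[0,D]$. $T=T(x)$ is generated by $M$ and $\mathrm{span}\{E^*_i\}$. $R^*=\sum_iE_{i+1}A^*E_i$, $F^*=\sum_iE_iA^*E_i$, $L^*=\sum_iE_{i-1}A^*E_i$. For an irreducible $T$-module $W$: endpoint $r=\min\{i:E^*_iW\neq0\}$, dual endpoint $t=\min\{i:E_iW\ne0\}$, diameter $d=|\{i:E^*_iW\ne0\}|-1$.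 In this setting $W$ is thin and dual thin; $c^*_i(W),a^*_i(W),b^*_i(W)$ ($0\le i\le d$) are defined by $R^*E_{t+i-1}v=c^*_i(W)E_{t+i}v$, $F^*E_{t+i}v=a^*_i(W)E_{t+i}v$, $L^*E_{t+i+1}v=b^*_i(W)E_{t+i}v$ for nonzero $v\in E^*_rW$. $O_{D+1}$ is the distance scheme of the Odd graph (vertices the $D$-subsets of a $(2D+1)$-set, adjacent when disjoint); $\Box_{2D+1}$ the distance scheme of the folded $(2D+1)$-cube. (Such $q,s,h,h^*$ exist for $Y$.) *)

(* Defs.v *)
From HB Require Import structures.
From mathcomp Require Import all_boot all_order all_algebra.
From mathcomp Require Import complex reals.

Set Implicit Arguments.
Unset Strict Implicit.
Unset Printing Implicit Defensive.

Import GRing.Theory.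
Local Open Scope ring_scope.

(* [isnum Y h i j] is p^h_{ij}. *)
Record sym_scheme (X : finType) (D : nat) := SymScheme {
  isrel :> 'I_D.+1 -> {set X * X};
  isrel_partition : partition [set isrel i | i : 'I_D.+1] [set: X * X];
  isrel_inj : injective isrel;
  isrel_diag : isrel ord0 = [set u | u.1 == u.2];
  isrel_sym : forall i y z, ((y, z) \in isrel i) = ((z, y) \in isrel i);
  isnum : 'I_D.+1 -> 'I_D.+1 -> 'I_D.+1 -> nat;
  isnumP : forall h i j y z, (y, z) \in isrel h ->
    #|[set w | ((y, w) \in isrel i) && ((w, z) \in isrel j)]| = isnum h i j
}.

(* The condition shared by the P-polynomial property (for p^h_{ij}) and the
   Q-polynomial property (for q^h_{ij}). *)
Definition triangular (Z : nmodType) (D : nat)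
    (p : 'I_D.+1 -> 'I_D.+1 -> 'I_D.+1 -> Z) : Prop :=
  forall h i j : 'I_D.+1,
    ([|| (i + j < h)%N, (h + j < i)%N | (h + i < j)%N] -> p h i j = 0) /\
    ([|| h == i + j :> nat, i == h + j :> nat | j == h + i :> nat]%N ->
       p h i j != 0).

Definition P_polynomial (X : finType) (D : nat) (Y : sym_scheme X D) : Prop :=
  triangular (isnum Y).

(* Index 1 is written [inord 1] throughout; this is the index of value 1 only
   when D >= 1. *)
Definition almost_bipartite (X : finType) (D : nat) (Y : sym_scheme X D) :
    Prop :=
  (forall i : 'I_D.+1, (i < D)%N -> isnum Y i (inord 1) i = 0%N) /\
  isnum Y ord_max (inord 1) ord_max <> 0%N.

(* Matrices with rows and columns indexed by X are matrices over 'I_#|X|, read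
   through [enum_val] and [enum_rank]; the standard module is the space of
   column vectors. *)
Section Matrices.
Variables (C : fieldType) (X : finType) (D : nat) (Y : sym_scheme X D).
Local Notation n := #|X|.

Definition assoc_mx (i : 'I_D.+1) : 'M[C]_n :=
  \matrix_(y, z) ((enum_val y, enum_val z) \in Y i)%:R.

Definition bose_mesner : {vspace 'M[C]_n} :=
  <<[seq assoc_mx i | i : 'I_D.+1]>>%VS.

Definition primitive_idempotents (E : 'I_D.+1 -> 'M[C]_n) : Prop :=
  [/\ basis_of bose_mesner [seq E i | i : 'I_D.+1],
      E ord0 = const_mx n%:R^-1,
      forall i j, E i *m E j = if i == j then E i else 0
    & \sum_i E i = 1%:M].

(* [kr h i j] is q^h_{ij}; the product on the left is the entrywise one. *)
Definition krein_parameters (E : 'I_D.+1 -> 'M[C]_n)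
    (kr : 'I_D.+1 -> 'I_D.+1 -> 'I_D.+1 -> C) : Prop :=
  forall i j, map2_mx *%R (E i) (E j) = n%:R^-1 *: \sum_h kr h i j *: E h.

Definition Q_polynomial (E : 'I_D.+1 -> 'M[C]_n) : Prop :=
  exists2 kr, krein_parameters E kr & triangular kr.

Variable x : X.

Definition dual_idem (i : 'I_D.+1) : 'M[C]_n :=
  \matrix_(y, z) ((y == z) && ((x, enum_val y) \in Y i))%:R.

Definition dual_assoc_mx (E : 'I_D.+1 -> 'M[C]_n) : 'M[C]_n :=
  diag_mx (\row_y (n%:R * E (inord 1) (enum_rank x) y)).

Definition dual_bose_mesner : {vspace 'M[C]_n} :=
  <<[seq dual_idem i | i : 'I_D.+1]>>%VS.

Inductive terwilliger : 'M[C]_n -> Prop :=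
| Terw_M B of B \in bose_mesner : terwilliger B
| Terw_Mstar B of B \in dual_bose_mesner : terwilliger B
| Terw_add B1 B2 of terwilliger B1 & terwilliger B2 : terwilliger (B1 + B2)
| Terw_scale k B of terwilliger B : terwilliger (k *: B)
| Terw_mul B1 B2 of terwilliger B1 & terwilliger B2 : terwilliger (B1 *m B2).

Definition T_module (W : {vspace 'cV[C]_n}) : Prop :=
  forall B v, terwilliger B -> v \in W -> B *m v \in W.

Definition irreducible_T_module (W : {vspace 'cV[C]_n}) : Prop :=
  [/\ T_module W, W <> 0%VS
    & forall U, T_module U -> (U <= W)%VS -> U = 0%VS \/ U = W].

Definition mx_img (B : 'M[C]_n) (W : {vspace 'cV[C]_n}) : {vspace 'cV[C]_n} :=
  (linfun (mulmx B) @: W)%VS.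

Definition first_nonzero (F : 'I_D.+1 -> 'M[C]_n) (W : {vspace 'cV[C]_n})
    (i : 'I_D.+1) : Prop :=
  mx_img (F i) W <> 0%VS /\
  forall j : 'I_D.+1, (j < i)%N -> mx_img (F j) W = 0%VS.

Definition endpoint (W : {vspace 'cV[C]_n}) (r : 'I_D.+1) : Prop :=
  first_nonzero dual_idem W r.

Definition dual_endpoint (E : 'I_D.+1 -> 'M[C]_n) (W : {vspace 'cV[C]_n})
    (t : 'I_D.+1) : Prop :=
  first_nonzero E W t.

Definition diameter (W : {vspace 'cV[C]_n}) (d : nat) : Prop :=
  #|[set i : 'I_D.+1 | mx_img (dual_idem i) W != 0%VS]| = d.+1.

(* E_k for an arbitrary integer k, with E_k = 0 outside [0, D]. *)
Definition idem_ext (E : 'I_D.+1 -> 'M[C]_n) (k : int) : 'M[C]_n :=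
  if k is Posz m then (if insub m is Some i then E i else 0) else 0.

Definition dual_raising (E : 'I_D.+1 -> 'M[C]_n) : 'M[C]_n :=
  \sum_(i < D.+1) idem_ext E (i%:Z + 1) *m dual_assoc_mx E *m E i.

Definition dual_flat (E : 'I_D.+1 -> 'M[C]_n) : 'M[C]_n :=
  \sum_(i < D.+1) E i *m dual_assoc_mx E *m E i.

Definition dual_lowering (E : 'I_D.+1 -> 'M[C]_n) : 'M[C]_n :=
  \sum_(i < D.+1) idem_ext E (i%:Z - 1) *m dual_assoc_mx E *m E i.

(* cs, as, bs restricted to 0 <= i <= d are c^*_i(W), a^*_i(W), b^*_i(W). *)
Definition dual_intersection_numbers (E : 'I_D.+1 -> 'M[C]_n)
    (W : {vspace 'cV[C]_n}) (r t : 'I_D.+1) (d : nat) (cs as_ bs : nat -> C) :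
    Prop :=
  forall (i : nat) (v : 'cV[C]_n), (i <= d)%N ->
    v \in mx_img (dual_idem r) W -> v != 0 ->
    let Ev (k : int) := idem_ext E (t%:Z + k) *m v in
    [/\ dual_raising E *m Ev (i%:Z - 1) = cs i *: Ev i%:Z,
        dual_flat E *m Ev i%:Z = as_ i *: Ev i%:Z
      & dual_lowering E *m Ev (i%:Z + 1) = bs i *: Ev i%:Z].

End Matrices.

Definition at_distance (V : finType) (e : rel V) (u v : V) (k : nat) : Prop :=
  (exists p : seq V, [/\ path e u p, last u p = v & size p = k]) /\
  (forall p : seq V, path e u p -> last u p = v -> (k <= size p)%N).

(* Isomorphism with the distance scheme of a graph, R_i going to distance i. *)
Definition iso_distance_scheme (X : finType) (D : nat) (Y : sym_scheme X D)
    (V : finType) (e : rel V) : Prop :=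
  exists2 f : X -> V, bijective f &
    forall (i : 'I_D.+1) (y z : X),
      (y, z) \in Y i <-> at_distance e (f y) (f z) i.

(* The Odd graph O_{D+1}. *)
Definition odd_vertex (D : nat) : finType :=
  {S : {set 'I_(2 * D + 1)} | #|S| == D}.

Definition odd_adj (D : nat) : rel (odd_vertex D) :=
  fun S S' => [disjoint val S & val S'].

(* The folded m-cube: the vertices of the m-cube are the subsets of 'I_m, and
   antipodal (i.e. complementary) vertices are identified. *)
Definition folded_vertex (m : nat) : finType :=
  {P : {set {set 'I_m}} | [exists S : {set 'I_m}, P == [set S; ~: S]]}.

Definition folded_adj (m : nat) : rel (folded_vertex m) :=
  fun P P' => [exists S in val P, exists S' in val P',
    #|(S :\: S') :|: (S' :\: S)| == 1%N].

(* Main.v *)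
(** Write R, L for the raising and lowering parts of A with respect to the E*_i;
    then A = R + L off the last subconstituent.  The closed form of theta_i
    gives the tridiagonal relation
      A^3 A* - A* A^3 + (q + 1 + 1/q) (A A* A^2 - A^2 A* A) = rho (A A* - A* A),
    whose blocks between the E*_i are relations between words in R, L and the
    flat part F = E*_D A E*_D.

    One of them says that F and R L commute on E*_D W.  For an irreducible
    module W of positive endpoint, a common eigenvector u of F and R L in E*_D W
    then generates W: by another block, R L^(i+1) u is a multiple of L^i u.
    (E*_D W is nonzero, as otherwise A would be bipartite on W, with spectrum
    symmetric about 0, but -theta_i is never an eigenvalue.)  Hence r + d = D, a
    nonzero v in E*_r W is cyclic for A, the vectors E_(t+i) v (0 <= i <= d)
    form a basis of W and L R v = y v for some scalar y.  If the endpoint is 0,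
    W is the primary module generated by the base vertex.

    Consequently v, A v and A^2 v - y v are eigenvectors of A*, for theta*_r,
    theta*_(r+1) and theta*_(r+2).  Comparing coefficients at E_(t+i) v gives
    three linear equations for c*_i(W), a*_i(W), b*_i(W); y is found from those
    with i = 0.

    The same equations on the primary module, where c*_i and b*_i are Krein
    parameters and so do not vanish, yield s q^k <> -1 for 1 <= k <= 2D + 1,
    except for k = D + 1, which is excluded because sum_i theta_i = p^D_{1D} is
    nonzero.  This is what keeps -theta_i out of the spectrum. *)

Require Import Defs.
From mathcomp Require Import all_boot all_order all_algebra.
From mathcomp Require Import complex reals.
From mathcomp Require Import ring zify.
Set Implicit Arguments.
Unset Strict Implicit.
Unset Printing Implicit Defensive.
Import Order.TTheory GRing.Theory Num.Theory.
Local Open Scope ring_scope.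

(** * Linear algebra: eigenvectors in stable subspaces and resolutions of the identity *)

Definition stable (K : fieldType) (n : nat) (B : 'M[K]_n)
    (U : {vspace 'cV[K]_n}) : Prop :=
  forall w, w \in U -> B *m w \in U.

(** By Cayley-Hamilton the product of the linear factors of the characteristic polynomial kills a
    nonzero [w] of [U]. Applying the factors one at a time stays in [U]; the last nonzero vector
    reached is an eigenvector. *)
Lemma eigenvector_in_stable (C : closedFieldType) (n : nat) (B : 'M[C]_n)
    (U : {vspace 'cV[C]_n}) :
  stable B U -> U <> 0%VS ->
  exists w k, [/\ w \in U, w != 0 & B *m w = k *: w].
Proof.
case: n B U => [|n] B U BU.
  by move=> U0; case: U0; apply/vspaceP => v; rewrite flatmx0 !mem0v.
move=> /eqP; rewrite -vpick0 => w0.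
have := memv_pick U; move: (vpick U) w0 => w w0 wU.
have [rs def_p] := closed_field_poly_normal (char_poly B).
rewrite (monicP (char_poly_monic B)) scale1r in def_p.
have hw0 : horner_mx B (\prod_(z <- rs) ('X - z%:P)) *m w = 0.
  by rewrite -def_p Cayley_Hamilton mul0mx.
elim: rs w w0 wU hw0 {def_p} => [|z rs IH] w w0 wU.
  by rewrite big_nil rmorph1 mul1mx => w00; rewrite w00 eqxx in w0.
rewrite big_cons mulrC rmorphM rmorphB /= horner_mx_X horner_mx_C -mulmxA.
have [/eqP|nz] := eqVneq ((B - z%:M) *m w) 0.
  rewrite mulmxBl mul_scalar_mx subr_eq0 => /eqP Bw _.
  by exists w, z.
apply: IH => //.
by rewrite mulmxBl mul_scalar_mx memvB ?memvZ ?BU.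
Qed.

Section Resolution.
Variables (K : fieldType) (n : nat) (I : finType) (F : I -> 'M[K]_n).

(** Common shape of the families E_i and E*_i, so that the same lemmas serve both sides. *)
Definition resolution : Prop :=
  (forall i j, F i *m F j = if i == j then F i else 0) /\ \sum_i F i = 1%:M.

Hypothesis resF : resolution.

Lemma resolution_sum (w : 'cV[K]_n) : w = \sum_i F i *m w.
Proof. by rewrite -mulmx_suml resF.2 mul1mx. Qed.

Lemma resolution_mul i j m (w : 'M[K]_(n, m)) :
  F i *m (F j *m w) = if i == j then F i *m w else 0.
Proof. by rewrite mulmxA resF.1; case: eqP; rewrite ?mul0mx. Qed.

Variables (B : 'M[K]_n) (tau : I -> K).
Hypothesis BF : forall i, B *m F i = tau i *: F i.

(** Multiplying [B] on the right by 1, written as the sum of the [F j], exhibits [B] as the sum of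
    the [tau j *: F j]; left and right eigenvalues therefore agree. *)
Lemma resolution_eigenr i : F i *m B = tau i *: F i.
Proof.
rewrite -[B]mulmx1 -resF.2 mulmx_sumr mulmx_sumr (bigD1 i) //=.
rewrite BF -scalemxAr resF.1 eqxx big1 ?addr0 // => j ji.
by rewrite BF -scalemxAr resF.1 eq_sym (negPf ji) scaler0.
Qed.

(* Lagrange interpolation: [\prod_(j != i) (B - tau j)] is a multiple of
   [F i]. *)
Lemma stable_resolution (U : {vspace 'cV[K]_n}) :
  injective tau -> stable B U -> forall i, stable (F i) U.
Proof.
move=> tau_inj BU i w wU.
have prodU (l : seq I) :
    \sum_k (\prod_(j <- l) (tau k - tau j)) *: (F k *m w) \in U.
  elim: l => [|j l IH].
    under eq_bigr => k _ do rewrite big_nil scale1r.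
    by rewrite -resolution_sum.
  have -> : \sum_k (\prod_(j0 <- j :: l) (tau k - tau j0)) *: (F k *m w)
     = B *m (\sum_k (\prod_(j0 <- l) (tau k - tau j0)) *: (F k *m w))
       - tau j *: (\sum_k (\prod_(j0 <- l) (tau k - tau j0)) *: (F k *m w)).
    rewrite mulmx_sumr scaler_sumr -sumrB; apply: eq_bigr => k _.
    rewrite big_cons -scalemxAr mulmxA BF -scalemxAl !scalerA -scalerBl.
    by congr (_ *: _); ring.
  by rewrite memvB ?memvZ ?BU.
have := prodU [seq j <- enum I | j != i].
rewrite (bigD1 i) //= [X in _ + X]big1 => [|k ki]; last first.
  apply/eqP; rewrite scaler_eq0 prodf_seq_eq0; apply/orP; left.
  by apply/hasP; exists k; rewrite ?subrr ?eqxx // mem_filter ki mem_enum.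
rewrite addr0 => cU.
set c := \prod_(j <- _) _ in cU.
have c0 : c != 0.
  rewrite prodf_seq_neq0; apply/allP => j; rewrite mem_filter => /andP[ji _].
  by rewrite subr_eq0; apply: contra ji => /eqP/tau_inj ->.
by rewrite -[F i *m w]scale1r -(mulVf c0) -scalerA memvZ.
Qed.

End Resolution.

Lemma mx_img_eq0P (C : fieldType) (X : finType) (B : 'M[C]_#|X|)
    (W : {vspace 'cV[C]_#|X|}) :
  mx_img B W = 0%VS <-> (forall w, w \in W -> B *m w = 0).
Proof.
split=> [W0 w wW | W0].
  by apply/eqP; rewrite -memv0 -W0 -[B *m w](lfunE (mulmx B)) memv_img.
apply/eqP; rewrite -subv0; apply/subvP => y /memv_imgP[w wW ->].
by rewrite lfunE /= W0 ?mem0v.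
Qed.

Lemma mem_mx_imgP (C : fieldType) (X : finType) (B : 'M[C]_#|X|)
    (W : {vspace 'cV[C]_#|X|}) y :
  y \in mx_img B W <-> exists2 w, w \in W & y = B *m w.
Proof.
split=> [/memv_imgP[w wW ->]|[w wW ->]]; first by exists w; rewrite ?lfunE.
by rewrite -[B *m w](lfunE (mulmx B)) memv_img.
Qed.

Lemma mx_img_neq0 (C : fieldType) (X : finType) (B : 'M[C]_#|X|)
    (W : {vspace 'cV[C]_#|X|}) :
  mx_img B W <> 0%VS -> exists2 w, w \in W & B *m w != 0.
Proof.
move/eqP; rewrite -vpick0 => nz.
have /mem_mx_imgP[w wW e] := memv_pick (mx_img B W).
by exists w; rewrite // -e.
Qed.

(** * Association schemes *)

Lemma span_imageP (K : fieldType) (V : vectType K) (I : finType) (F : I -> V)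
    (v : V) :
  v \in <<[seq F i | i : I]>>%VS <-> exists c : I -> K, v = \sum_i c i *: F i.
Proof.
split=> [|[c ->]]; last first.
  apply: memv_suml => i _; apply: memvZ; apply: memv_span.
  by apply: map_f; rewrite mem_enum.
rewrite span_def big_map big_enum /= => /memv_sumP[vs vsP ->].
have /fin_all_exists[c cP] : forall i, exists c, vs i = c *: F i.
  by move=> i; have /vlineP[c ->] := vsP i isT; exists c.
by exists c; apply: eq_bigr => i _.
Qed.

Lemma triangular_far (Z : nmodType) (D : nat)
    (p : 'I_D.+1 -> 'I_D.+1 -> 'I_D.+1 -> Z) (h i j : 'I_D.+1) :
  triangular p -> (i + j < h)%N || (h + j < i)%N || (h + i < j)%N ->
  p h i j = 0.
Proof. by move=> pT far; apply: (pT h i j).1; rewrite orbA. Qed.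

Lemma triangular_near (Z : nmodType) (D : nat)
    (p : 'I_D.+1 -> 'I_D.+1 -> 'I_D.+1 -> Z) (h i j : 'I_D.+1) :
  triangular p ->
  h = (i + j)%N :> nat \/ i = (h + j)%N :> nat \/ j = (h + i)%N :> nat ->
  p h i j != 0.
Proof.
move=> pT near; apply: (pT h i j).2.
by case: near => [|[|]] ->; rewrite eqxx ?orbT.
Qed.

Section Scheme.
Variables (C : numClosedFieldType) (X : finType) (D : nat).
Variable Y : sym_scheme X D.
Local Notation n := #|X|.
Local Notation assoc := (assoc_mx C Y).

Lemma rel_total y z : exists i, (y, z) \in Y i.
Proof.
have /and3P[/eqP cov _ _] := isrel_partition Y.
have: (y, z) \in [set: X * X] by rewrite inE.
by rewrite -cov => /bigcupP[_ /imsetP[i _ ->]]; exists i.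
Qed.

Lemma rel_uniq i j u : u \in Y i -> u \in Y j -> i = j.
Proof.
have /and3P[_ /trivIsetP tI _] := isrel_partition Y.
move=> ui uj; apply: (@isrel_inj _ _ Y); apply/eqP; apply: contraT => nij.
have := tI (Y i) (Y j) (imset_f _ isT) (imset_f _ isT) nij.
by rewrite -setI_eq0 => /eqP/setP/(_ u); rewrite !inE ui uj.
Qed.

Lemma relE i j u : u \in Y i -> (u \in Y j) = (i == j).
Proof. by move=> ui; apply/idP/eqP => [/(rel_uniq ui)|<-]. Qed.

Lemma isnum_neq0 h i j y w z : (y, z) \in Y h -> (y, w) \in Y i ->
  (w, z) \in Y j -> isnum Y h i j != 0%N.
Proof.
move=> yz yw wz; rewrite -(isnumP i j yz) -lt0n; apply/card_gt0P.
by exists w; rewrite inE yw.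
Qed.

Lemma isnum_ex h i j y z : (y, z) \in Y h -> isnum Y h i j != 0%N ->
  exists2 w, (y, w) \in Y i & (w, z) \in Y j.
Proof.
move=> yz; rewrite -(isnumP i j yz) -lt0n => /card_gt0P[w].
by rewrite inE => /andP[]; exists w.
Qed.

Lemma rel_diag y : (y, y) \in Y ord0.
Proof. by rewrite isrel_diag inE. Qed.

Hypothesis Ppoly : P_polynomial Y.

(** The triple (0, i, i) satisfies i = 0 + i, so p^0_{ii} is nonzero: every valency is positive. *)
Lemma sphere_neq0 x i : exists y, (x, y) \in Y i.
Proof.
have [|y] := @isnum_ex ord0 i i x x (rel_diag x); last by exists y.
by apply: (triangular_near Ppoly); right; left.
Qed.

Lemma assoc_tr i : (assoc i)^T = assoc i.
Proof. by apply/matrixP => y z; rewrite !mxE isrel_sym. Qed.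

Lemma assoc0 : assoc ord0 = 1%:M.
Proof.
apply/matrixP => y z; rewrite !mxE isrel_diag inE /=.
by rewrite (inj_eq enum_val_inj).
Qed.

Lemma assoc_mul i j :
  assoc i *m assoc j = \sum_h (isnum Y h i j)%:R *: assoc h.
Proof.
apply/matrixP => y z; rewrite summxE mxE.
have [h yz] := rel_total (enum_val y) (enum_val z).
rewrite [RHS](bigD1 h) //= [X in _ + X]big1 ?addr0 => [|k kh]; last first.
  by rewrite !mxE (relE _ yz) eq_sym (negPf kh) mulr0.
rewrite !mxE yz mulr1 -(isnumP i j yz).
set S := [set w | _].
have -> : #|S|%:R = \sum_(w in S) 1 :> C by rewrite -sum1_card natr_sum.
rewrite {}/S.
rewrite (reindex_onto enum_rank enum_val) => [|w _]; last exact: enum_valK.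
under eq_bigl => w do rewrite enum_rankK eqxx.
rewrite [RHS]big_mkcond; apply: eq_bigr => w _; rewrite !mxE enum_rankK inE.
by case: (_ \in _); case: (_ \in _); rewrite /= ?mulr0 ?mul0r ?mulr1.
Qed.

Lemma val_inord1 : (0 < D)%N -> (inord 1 : 'I_D.+1) = 1%N :> nat.
Proof. by move=> D0; rewrite inordK. Qed.

Lemma adj_assoc_mul i : (0 < D)%N ->
  assoc (inord 1) *m assoc i =
  \sum_(h : 'I_D.+1 | (h <= i.+1)%N) (isnum Y h (inord 1) i)%:R *: assoc h.
Proof.
move=> D0; rewrite assoc_mul [RHS]big_mkcond; apply: eq_bigr => h _.
case: leqP => // hi; rewrite (triangular_far Ppoly) ?scale0r //.
by rewrite val_inord1 // add1n hi.
Qed.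

Lemma adj_isnum_far (i j : 'I_D.+1) : (0 < D)%N ->
  (i.+1 < j)%N || (j.+1 < i)%N -> isnum Y j (inord 1) i = 0%N.
Proof.
move=> D0 far; apply: (triangular_far Ppoly); rewrite val_inord1 //; lia.
Qed.

(* [A_1 A_m] is a nonzero multiple of [A_{m+1}] up to [A_0, ..., A_m]. *)
Lemma assoc_generate (P : 'M[C]_n -> Prop) : (0 < D)%N ->
  P 1%:M -> P (assoc (inord 1)) ->
  (forall B1 B2, P B1 -> P B2 -> P (B1 + B2)) ->
  (forall k B, P B -> P (k *: B)) ->
  (forall B1 B2, P B1 -> P B2 -> P (B1 *m B2)) ->
  forall B, B \in bose_mesner C Y -> P B.
Proof.
move=> D0 P1 PA Padd Pscale Pmul.
have P0 : P 0 by rewrite -(scale0r 1%:M); apply: (Pscale).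
have Passoc m (mD : (m < D.+1)%N) : P (assoc (Ordinal mD)).
  elim/ltn_ind: m mD => -[|m] IH mD.
    suff -> : Ordinal mD = ord0 by rewrite assoc0.
    exact: val_inj.
  have mD' := ltnW mD; pose i := Ordinal mD'; pose i1 := Ordinal mD.
  have := adj_assoc_mul i D0; rewrite (bigD1 i1) ?leqnn //=.
  set c := (isnum _ _ _ _)%:R; set S := \sum_(_ | _) _ => def.
  have c0 : c != 0.
    rewrite pnatr_eq0; apply: (triangular_near Ppoly); left.
    by rewrite val_inord1 //= add1n.
  have -> : assoc i1 = c^-1 *: (assoc (inord 1) *m assoc i + (-1) *: S).
    by rewrite def scaleN1r addrK scalerA mulVf ?scale1r.
  apply: (Pscale); apply: (Padd); first by apply: (Pmul) => //; apply: (IH).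
  apply: (Pscale); rewrite /S; apply: big_ind => // h /andP[hi hi1].
  apply: (Pscale); case: h hi hi1 => h hD /= hi hi1; apply: (IH).
  rewrite ltn_neqAle hi andbT.
  by apply: contra hi1 => /eqP e; apply/eqP/val_inj.
move=> B /span_imageP[c ->]; apply: big_ind => // i _; apply: (Pscale).
by case: i => i iD; apply: (Passoc).
Qed.

End Scheme.

(** The trace is the sum of the squared absolute values of the entries. This positivity is behind
    both the reality of the E_i and the vanishing of the far blocks of A*. *)
Lemma frobenius_eq0 (C : numClosedFieldType) (n : nat) (B : 'M[C]_n) :
  \tr (B *m (map_mx Num.conj B)^T) = 0 -> B = 0.
Proof.
move=> tr0; apply/matrixP => y z; rewrite mxE.
have norm_ge0 u : 0 <= \sum_v `|B u v| ^+ 2.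
  by apply: sumr_ge0 => v _; rewrite exprn_ge0.
have tr_norm : \tr (B *m (map_mx Num.conj B)^T) = \sum_u \sum_v `|B u v| ^+ 2.
  apply: eq_bigr => u _; rewrite mxE; apply: eq_bigr => v _.
  by rewrite !mxE normCK.
move: tr0; rewrite tr_norm => /eqP.
rewrite psumr_eq0 => [/allP/(_ y (mem_index_enum y))|u _] //=.
rewrite psumr_eq0 => [/allP/(_ z (mem_index_enum z))|v _] /=.
  by rewrite expf_eq0 normr_eq0 => /eqP.
by rewrite exprn_ge0.
Qed.

(** * Primitive idempotents: distinct eigenvalues, real entries, sum of the eigenvalues *)

Section Idempotents.
Variables (C : numClosedFieldType) (X : finType) (D : nat).
Variable Y : sym_scheme X D.
Hypothesis Ppoly : P_polynomial Y.
Hypothesis D_gt0 : (0 < D)%N.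
Local Notation n := #|X|.
Local Notation assoc := (assoc_mx C Y).
Local Notation A := (assoc (inord 1)).
Variable E : 'I_D.+1 -> 'M[C]_n.
Hypothesis Eprim : primitive_idempotents Y E.
Variable theta : 'I_D.+1 -> C.
Hypothesis AE : forall i, A *m E i = theta i *: E i.

Lemma idem_resolution : resolution E.
Proof. by have [] := Eprim. Qed.

Lemma bose_mesner_assocP B :
  B \in bose_mesner C Y <-> exists c, B = \sum_i c i *: assoc i.
Proof. exact: span_imageP. Qed.

Lemma bose_mesner_idemP B :
  B \in bose_mesner C Y <-> exists c, B = \sum_i c i *: E i.
Proof.
have [/andP[/eqP <- _] _ _ _] := Eprim; exact: span_imageP.
Qed.

Lemma idem_in i : E i \in bose_mesner C Y.
Proof.
apply/bose_mesner_idemP; exists (fun j => (i == j)%:R).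
rewrite (bigD1 i) //= eqxx scale1r big1 ?addr0 // => j ji.
by rewrite eq_sym (negPf ji) scale0r.
Qed.

Lemma assoc_in i : assoc i \in bose_mesner C Y.
Proof. by apply: memv_span; apply: map_f; rewrite mem_enum. Qed.

Lemma idem_neq0 i : E i != 0.
Proof.
have [/andP[_ /free_not0]] := Eprim.
by move=> /(_ (E i)) H _ _ _; apply: H; apply: map_f; rewrite mem_enum.
Qed.

(** The matrices acting by one common scalar on [E a] and [E b] form an algebra. If theta_a =
    theta_b it contains A, hence all of M, hence [E a]; but [E a] acts as 1 on itself and as 0 on
    [E b]. *)
Lemma theta_inj : injective theta.
Proof.
move=> a b tab.
pose P B := exists k, B *m E a = k *: E a /\ B *m E b = k *: E b.
have allP B : B \in bose_mesner C Y -> P B.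
  apply: (assoc_generate Ppoly) => //.
  - by exists 1; rewrite !mul1mx !scale1r.
  - by exists (theta a); rewrite AE {3}tab AE.
  - move=> B1 B2 [k1 [a1 b1]] [k2 [a2 b2]]; exists (k1 + k2).
    by rewrite !mulmxDl !scalerDl a1 a2 b1 b2.
  - move=> k B1 [k1 [a1 b1]]; exists (k * k1).
    by rewrite -!scalemxAl a1 b1 !scalerA.
  - move=> B1 B2 [k1 [a1 b1]] [k2 [a2 b2]]; exists (k1 * k2).
    by rewrite -!mulmxA a2 b2 -!scalemxAr a1 b1 !scalerA mulrC.
have [k [ka kb]] := allP _ (idem_in a).
apply/eqP; apply: contraT => nab.
have [resE _] := idem_resolution.
move: ka kb; rewrite !resE eqxx (negPf nab) => ka /esym/eqP.
rewrite scaler_eq0 (negPf (idem_neq0 b)) orbF => /eqP k0.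
by move: (idem_neq0 a); rewrite ka k0 scale0r eqxx.
Qed.

Lemma idem_tr i : (E i)^T = E i.
Proof.
have /bose_mesner_assocP[c ->] := idem_in i.
by rewrite raddf_sum; apply: eq_bigr => j _; rewrite /= linearZ /= assoc_tr.
Qed.

Lemma assoc_conj i : map_mx Num.conj (assoc i) = assoc i.
Proof. by apply/matrixP => y z; rewrite !mxE conjC_nat. Qed.

(** As [E i] is symmetric, its product with its conjugate is nonzero by positivity. As A is real,
    moving A across such products shows first that theta_i is real, then that every other [E j]
    annihilates the conjugate of [E i]. *)
Lemma idem_conj i : map_mx Num.conj (E i) = E i.
Proof.
have [resE sumE] := idem_resolution.
have trconj : (map_mx Num.conj (E i))^T = map_mx Num.conj (E i).
  by apply/matrixP => y z; rewrite !mxE -{1}idem_tr mxE.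
have EcE : E i *m map_mx Num.conj (E i) != 0.
  apply/negP => /eqP EcE0; move: (idem_neq0 i).
  by rewrite [E i]frobenius_eq0 ?eqxx // trconj EcE0 mxtrace0.
have AcE : A *m map_mx Num.conj (E i) = (theta i)^* *: map_mx Num.conj (E i).
  by rewrite -{1}assoc_conj -map_mxM AE map_mxZ.
have EA := resolution_eigenr idem_resolution AE.
have th_real : (theta i)^* = theta i.
  apply/eqP; rewrite -subr_eq0; have := EcE; apply: contraR => th.
  suff : ((theta i)^* - theta i) *: (E i *m map_mx Num.conj (E i)) == 0.
    by rewrite scaler_eq0 (negPf th).
  rewrite scalerBl (scalemxAr (theta i)^*) -AcE mulmxA EA.
  by rewrite -scalemxAl subrr.
have EjcE j : j != i -> E j *m map_mx Num.conj (E i) = 0.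
  move=> ji; apply/eqP.
  suff : (theta i - theta j) *: (E j *m map_mx Num.conj (E i)) == 0.
    by rewrite scaler_eq0 subr_eq0 (inj_eq theta_inj) eq_sym (negPf ji).
  rewrite scalerBl -{1}th_real (scalemxAr (theta i)^*) -AcE mulmxA EA.
  by rewrite -scalemxAl subrr.
(* The conjugate of [E i] is thus [E i] times that conjugate. Conjugating and then transposing this
   identity shows that [E i] is the same product. *)
have def : map_mx Num.conj (E i) = E i *m map_mx Num.conj (E i).
  rewrite -[LHS]mul1mx -sumE mulmx_suml (bigD1 i) //= big1 ?addr0 //.
have conjK : map_mx Num.conj (map_mx Num.conj (E i)) = E i.
  by apply/matrixP => y z; rewrite !mxE conjCK.
have def' : E i = map_mx Num.conj (E i) *m E i.
  by rewrite -{1 3}conjK {1}def map_mxM.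
by rewrite [RHS]def' -[RHS]trmxK trmx_mul idem_tr trconj -def trconj.
Qed.

Lemma card_neq0 (x : X) : n%:R != 0 :> C.
Proof. by rewrite pnatr_eq0 -lt0n; apply/card_gt0P; exists x. Qed.

Lemma idem0E y z : E ord0 y z = n%:R^-1.
Proof. by have [_ -> _ _] := Eprim; rewrite mxE. Qed.

(** Multiplication by A on M is diagonal with entries theta_i in the basis of the E_i, and has
    entries p^j_{1i} in the basis of the A_i; the two traces agree. *)
Lemma trace_theta : \sum_i theta i = \sum_i (isnum Y i (inord 1) i)%:R.
Proof.
have /fin_all_exists[p defE] : forall i, exists c, E i = \sum_j c j *: assoc j.
  by move=> i; apply/bose_mesner_assocP/idem_in.
have /fin_all_exists[s defA] : forall i, exists c, assoc i = \sum_j c j *: E j.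
  by move=> i; apply/bose_mesner_idemP/assoc_in.
have free_assoc (c c' : 'I_D.+1 -> C) :
    \sum_j c j *: assoc j = \sum_j c' j *: assoc j -> c =1 c'.
  move=> eqc j.
  (* A point exists because over an empty index set the matrix [E j] would be zero. *)
  have x0 : X.
    have /eqP := idem_neq0 j; have [//|noX] := pickP (@predT X).
    case; apply/matrixP => y; by have := noX (enum_val y).
  have [y xy] := sphere_neq0 Ppoly x0 j.
  move/matrixP/(_ (enum_rank x0) (enum_rank y)): eqc.
  have val (g : 'I_D.+1 -> C) :
      (\sum_j g j *: assoc j) (enum_rank x0) (enum_rank y) = g j.
    rewrite summxE (bigD1 j) //= big1 ?addr0 => [|k kj].
      by rewrite !mxE !enum_rankK xy mulr1.
    by rewrite !mxE !enum_rankK (relE _ xy) eq_sym (negPf kj) mulr0.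
  by rewrite !val.
(* [P] and [S] are the two transition matrices between the bases, and [B] is multiplication by A in
   the basis of the A_i. *)
pose P := \matrix_(i, j) p i j; pose S := \matrix_(i, j) s i j.
pose B := \matrix_(i, j) (isnum Y j (inord 1) i)%:R : 'M[C]_D.+1.
have SP1 : S *m P = 1%:M.
  apply/matrixP => i j; rewrite !mxE.
  have /free_assoc/(_ j) : \sum_j (\sum_k s i k * p k j) *: assoc j
      = \sum_j (i == j)%:R *: assoc j.
    rewrite [RHS](bigD1 i) //= eqxx scale1r [X in _ + X]big1 ?addr0; last first.
      by move=> k ki; rewrite eq_sym (negPf ki) scale0r.
    rewrite [RHS]defA; under eq_bigr => k _ do rewrite scaler_suml.
    rewrite exchange_big; apply: eq_bigr => k _ /=; rewrite defE scaler_sumr.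
    by apply: eq_bigr => l _; rewrite scalerA.
  by move=> <-; apply: eq_bigr => k _; rewrite !mxE.
have PBdiag : P *m B = diag_mx (\row_i theta i) *m P.
  apply/matrixP => i j; rewrite mul_diag_mx !mxE.
  have /free_assoc/(_ j) :
      \sum_j (\sum_k p i k * (isnum Y j (inord 1) k)%:R) *: assoc j
      = \sum_j (theta i * p i j) *: assoc j.
    transitivity (A *m E i).
      rewrite defE mulmx_sumr; under eq_bigr => k _ do rewrite scaler_suml.
      rewrite exchange_big; apply: eq_bigr => k _ /=; rewrite -scalemxAr.
      rewrite assoc_mul scaler_sumr.
      by apply: eq_bigr => l _; rewrite scalerA.
    rewrite AE defE scaler_sumr.
    by apply: eq_bigr => l _; rewrite scalerA.
  by move=> <-; apply: eq_bigr => k _; rewrite !mxE.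
have -> : \sum_i theta i = \tr (diag_mx (\row_i theta i)).
  by rewrite mxtrace_diag; apply: eq_bigr => i _; rewrite mxE.
rewrite -[diag_mx _]mulmx1 -(mulmx1C SP1) mulmxA -PBdiag -mulmxA mxtrace_mulC.
rewrite -mulmxA SP1 mulmx1.
by apply: eq_bigr => i _; rewrite mxE.
Qed.

End Idempotents.

(** * Dual idempotents, the dual associate matrix and the base vertex *)

Section DualSide.
Variables (C : numClosedFieldType) (X : finType) (D : nat).
Variable Y : sym_scheme X D.
Hypothesis Ppoly : P_polynomial Y.
Hypothesis D_gt0 : (0 < D)%N.
Local Notation n := #|X|.
Local Notation assoc := (assoc_mx C Y).
Local Notation A := (assoc (inord 1)).
Variable E : 'I_D.+1 -> 'M[C]_n.
Hypothesis Eprim : primitive_idempotents Y E.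
Variable theta : 'I_D.+1 -> C.
Hypothesis AE : forall i, A *m E i = theta i *: E i.
Variable kr : 'I_D.+1 -> 'I_D.+1 -> 'I_D.+1 -> C.
Hypothesis krP : krein_parameters E kr.
Hypothesis krT : triangular kr.
Variable x : X.
Local Notation Es := (dual_idem C Y x).
Local Notation As := (dual_assoc_mx x E).
Local Notation ex := (delta_mx (enum_rank x) 0 : 'cV[C]_n).

Lemma dual_idem_diag i :
  Es i = diag_mx (\row_y ((x, enum_val y) \in Y i)%:R).
Proof.
apply/matrixP => y z; rewrite !mxE.
by case: eqP => [->|]; rewrite ?mulr1n ?mulr0n.
Qed.

Lemma dual_idem_resolution : resolution Es.
Proof.
split=> [i j|].
  rewrite !dual_idem_diag mulmx_diag; case: eqP => [<-|/eqP ij].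
    by congr diag_mx; apply/rowP => y; rewrite !mxE; case: (_ \in _);
      rewrite ?mulr1 ?mulr0.
  rewrite -[RHS](linear0 (@diag_mx C n)).
  congr diag_mx; apply/rowP => y; rewrite !mxE.
  have [xy|_] := boolP ((x, _) \in Y i); last by rewrite mul0r.
  by rewrite (relE _ xy) (negPf ij) mulr0.
apply/matrixP => y z; rewrite summxE.
under eq_bigr => i _ do rewrite mxE; rewrite mxE.
have [i xy] := rel_total Y x (enum_val y).
rewrite (bigD1 i) //= xy andbT big1 ?addr0 // => j ji.
by rewrite (relE j xy) [_ == j]eq_sym (negPf ji) andbF.
Qed.

Lemma dual_idem_adj i j :
  (isnum Y j (inord 1) i = 0)%N -> Es i *m A *m Es j = 0.
Proof.
move=> p0; apply/matrixP => y z; rewrite !dual_idem_diag.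
rewrite mul_mx_diag mul_diag_mx !mxE.
have [xy|_] := boolP ((x, enum_val y) \in Y i); last by rewrite !mul0r.
have [yz|_] := boolP ((enum_val y, enum_val z) \in Y _); last first.
  by rewrite mulr0 mul0r.
have [xz|_] := boolP ((x, enum_val z) \in Y j); last by rewrite mulr0.
move: xz yz xy; rewrite isrel_sym => xz; rewrite isrel_sym => yz.
by rewrite isrel_sym => xy; move: (isnum_neq0 xz yz xy); rewrite p0.
Qed.

Lemma dual_idem_adj_far (i j : 'I_D.+1) : (i.+1 < j)%N || (j.+1 < i)%N ->
  Es i *m A *m Es j = 0.
Proof. by move=> far; rewrite dual_idem_adj ?adj_isnum_far. Qed.

Lemma dual_assoc_diag :
  As = diag_mx (\row_y (n%:R * E (inord 1) (enum_rank x) y)).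
Proof. by []. Qed.

(** This is column [x] of the Krein identity for [E (inord 1)] and [E j]. It makes the Krein
    parameters the dual intersection numbers of the module generated by the base vertex. *)
Lemma dual_assoc_vertex j :
  As *m (E j *m ex) = \sum_h kr h (inord 1) j *: (E h *m ex).
Proof.
have := krP (inord 1) j => /matrixP krE.
apply/colP => y; rewrite mul_diag_mx -colE !mxE -mulrA.
have := krE y (enum_rank x); rewrite mxE => krE'.
rewrite -[E (inord 1)](idem_tr Eprim) mxE krE' mxE mulrA.
rewrite divff ?card_neq0 // mul1r !summxE; apply: eq_bigr => h _.
by rewrite -colE !mxE.
Qed.

(** Summing over all base vertices merges two diagonal matrices into one entrywise factor E_1, to
    which the Krein identity applies; the reason is that E_1 is symmetric and idempotent. *)
Lemma sum_dual_assoc (y z : 'I_n) :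
  \sum_(u < n) dual_assoc_mx (enum_val u) E y y
    * dual_assoc_mx (enum_val u) E z z
  = n%:R ^+ 2 * E (inord 1) y z.
Proof.
have [resE _] := idem_resolution Eprim.
have -> : E (inord 1) y z = (E (inord 1) *m E (inord 1)) y z.
  by rewrite resE eqxx.
rewrite [in RHS]mxE mulr_sumr; apply: eq_bigr => u _.
rewrite !mxE !eqxx !mulr1n enum_valK -[in E _ y u](idem_tr Eprim) mxE; ring.
Qed.

(* The squared Frobenius norms of [E_i A*(u) E_j], summed over the base vertices
   [u], give [n q^j_{1i} \tr E_j]. *)
Lemma idem_dual_assoc_far (i j : 'I_D.+1) : (i.+1 < j)%N || (j.+1 < i)%N ->
  E i *m As *m E j = 0.
Proof.
move=> far; have [resE _] := idem_resolution Eprim.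
have conjE := idem_conj Ppoly D_gt0 Eprim AE.
pose N (u : 'I_n) := E i *m dual_assoc_mx (enum_val u) E *m E j.
have trN u : \tr (N u *m (map_mx Num.conj (N u))^T) =
    \sum_y \sum_z dual_assoc_mx (enum_val u) E y y
       * dual_assoc_mx (enum_val u) E z z * (E j y z * E i z y).
  have -> : (map_mx Num.conj (N u))^T
      = E j *m dual_assoc_mx (enum_val u) E *m E i.
    rewrite /N !map_mxM !conjE !trmx_mul !(idem_tr Eprim) mulmxA.
    congr (_ *m _ *m _); apply/matrixP => y z; rewrite !mxE.
    have [->|zy] := eqVneq z y.
      rewrite !mulr1n rmorphM /= rmorph_nat; congr (_ * _).
      by rewrite -[in RHS](conjE (inord 1)) [in RHS]mxE.
    by rewrite !mulr0n rmorph0.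
  rewrite /N !mulmxA -(mulmxA _ (E j) (E j)) resE eqxx mxtrace_mulC.
  rewrite !mulmxA resE eqxx.
  rewrite -!mulmxA mxtrace_mulC !mulmxA.
  apply: eq_bigr => y _; rewrite mxE; apply: eq_bigr => z _.
  rewrite /dual_assoc_mx -mulmxA mul_diag_mx mxE mul_mx_diag !mxE.
  by rewrite !eqxx !mulr1n; ring.
have kr0 : kr j (inord 1) i = 0.
  by apply: (triangular_far krT); rewrite val_inord1 //; lia.
have sum0 : \sum_(u < n) \tr (N u *m (map_mx Num.conj (N u))^T) = 0.
  under eq_bigr => u _ do rewrite trN.
  rewrite exchange_big /=; under eq_bigr => y _ do rewrite exchange_big /=.
  under eq_bigr => y _ do under eq_bigr => z _ do
    rewrite -mulr_suml sum_dual_assoc.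
  transitivity (n%:R ^+ 2 * \tr (map2_mx *%R (E (inord 1)) (E i) *m E j)).
    rewrite mulr_sumr; apply: eq_bigr => y _; rewrite mxE mulr_sumr.
    apply: eq_bigr => z _; rewrite mxE.
    rewrite -[in E j y z](idem_tr Eprim) -[in E i z y](idem_tr Eprim) !mxE.
    ring.
  rewrite krP -scalemxAl mulmx_suml (bigD1 j) //= -scalemxAl kr0 scale0r add0r.
  rewrite big1 ?scaler0 ?mxtrace0 ?mulr0 // => h hj.
  by rewrite -scalemxAl resE (negPf hj) scaler0.
have tr_ge0 u : 0 <= \tr (N u *m (map_mx Num.conj (N u))^T).
  apply: sumr_ge0 => y _; rewrite mxE; apply: sumr_ge0 => z _.
  by rewrite !mxE mul_conjC_ge0.
apply: (@frobenius_eq0 C n); apply/eqP.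
move/eqP: sum0; rewrite psumr_eq0 // => /allP/(_ (enum_rank x)).
by rewrite mem_index_enum /N enum_rankK => /(_ isT).
Qed.

Variable thetas : 'I_D.+1 -> C.
Hypothesis AsEs : forall i, As *m Es i = thetas i *: Es i.

Lemma thetas_entry i y : (x, y) \in Y i ->
  E (inord 1) (enum_rank x) (enum_rank y) = n%:R^-1 * thetas i.
Proof.
move=> xy; have /matrixP/(_ (enum_rank y) (enum_rank y)) := AsEs i.
rewrite dual_assoc_diag mul_diag_mx !mxE !eqxx enum_rankK xy !mulr1 => <-.
by rewrite mulrA mulVf ?mul1r // card_neq0.
Qed.

(** Dual to [theta_inj], with the entrywise product. If theta*_a = theta*_b, then E_1 does not
    separate the entries (x, y) and (x, z), where [y] and [z] lie in relations [a] and [b] to [x].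
    By the Q-polynomial property E_1 generates M entrywise, yet A_a separates them. *)
Lemma thetas_inj : injective thetas.
Proof.
move=> a b tab.
have [y xy] := sphere_neq0 Ppoly x a; have [z xz] := sphere_neq0 Ppoly x b.
pose P (B : 'M[C]_n) := B (enum_rank x) (enum_rank y)
                       = B (enum_rank x) (enum_rank z).
have Padd B1 B2 : P B1 -> P B2 -> P (B1 + B2).
  by rewrite /P !mxE => -> ->.
have Pscale k B : P B -> P (k *: B) by rewrite /P !mxE => ->.
have Phad B1 B2 : P B1 -> P B2 -> P (map2_mx *%R B1 B2).
  by rewrite /P !mxE => -> ->.
have P0 : P 0 by rewrite /P !mxE.
have P1 : P (E (inord 1)).
  by rewrite /P (thetas_entry xy) (thetas_entry xz) tab.
have PE m (mD : (m < D.+1)%N) : P (E (Ordinal mD)).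
  elim/ltn_ind: m mD => -[|m] IH mD.
    suff -> : Ordinal mD = ord0 by rewrite /P !(idem0E Eprim).
    exact: val_inj.
  have mD' := ltnW mD; pose i := Ordinal mD'; pose i1 := Ordinal mD.
  have := krP (inord 1) i => /(congr1 (fun B => n%:R *: B)).
  rewrite scalerA divff ?card_neq0 // scale1r (bigD1 i1) //=.
  set c := kr _ _ _; set S := \sum_(_ | _) _ => def.
  have c0 : c != 0.
    apply: (triangular_near krT); left.
    by rewrite val_inord1 //= add1n.
  have -> : E i1 = c^-1 *: (n%:R *: (map2_mx *%R (E (inord 1)) (E i))
                            + (-1) *: S).
    by rewrite def scaleN1r addrK scalerA mulVf ?scale1r.
  apply: (Pscale); apply: (Padd).
    by apply: (Pscale); apply: (Phad) => //; apply: (IH).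
  apply: (Pscale); rewrite /S; apply: big_ind => // h hi1.
  case: (leqP h i1) => hi; last first.
    rewrite [kr _ _ _](triangular_far krT) ?scale0r //.
    by rewrite val_inord1 // add1n hi.
  apply: (Pscale); case: h hi1 hi => h hD /= hi1 hi; apply: (IH).
  rewrite ltn_neqAle hi andbT.
  by apply: contra hi1 => /eqP e; apply/eqP/val_inj.
have /(bose_mesner_idemP Eprim)[c defA] := assoc_in C Y a.
have : P (assoc a).
  rewrite defA; apply: big_ind => // i _; apply: (Pscale).
  by case: i => i iD; apply: PE.
rewrite /P !mxE !enum_rankK xy (relE _ xz).
by case: (eqVneq b a) => [->//|_] /eqP; rewrite oner_eq0.
Qed.

(** A matrix of M is determined by its column [x], since every relation occurs from [x]. *)
Lemma vertex_idem_neq0 j : E j *m ex != 0.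
Proof.
apply/eqP => Eex; have /(bose_mesner_assocP)[c defE] := idem_in Eprim j.
have c0 i : c i = 0.
  have [y xy] := sphere_neq0 Ppoly x i.
  have := Eex; rewrite -colE => /colP/(_ (enum_rank y)); rewrite !mxE defE.
  rewrite summxE (bigD1 i) //= big1 ?addr0 => [|k ki].
    by rewrite !mxE !enum_rankK isrel_sym xy mulr1.
  by rewrite !mxE !enum_rankK isrel_sym (relE _ xy) eq_sym (negPf ki) mulr0.
have := idem_neq0 Eprim j; rewrite defE big1 ?eqxx // => i _.
by rewrite c0 scale0r.
Qed.

Lemma dual_idem_vertex i : Es i *m (assoc i *m ex) = assoc i *m ex.
Proof.
rewrite dual_idem_diag; apply/colP => y; rewrite mul_diag_mx -colE !mxE.
by rewrite enum_rankK isrel_sym; case: (_ \in _); rewrite ?mulr1 ?mulr0.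
Qed.

Lemma assoc_vertex_neq0 i : assoc i *m ex != 0.
Proof.
have [y xy] := sphere_neq0 Ppoly x i.
apply/eqP; rewrite -colE => /colP/(_ (enum_rank y)); rewrite !mxE !enum_rankK.
by rewrite isrel_sym xy => /eqP; rewrite oner_eq0.
Qed.

Lemma dual_idem0 (w : 'cV[C]_n) : Es ord0 *m w = w (enum_rank x) 0 *: ex.
Proof.
rewrite dual_idem_diag; apply/colP => y; rewrite mul_diag_mx !mxE.
rewrite isrel_diag inE /= eqxx andbT -(inj_eq enum_rank_inj) enum_valK eq_sym.
by case: eqP => [->|]; rewrite ?mulr1 ?mul1r ?mulr0 ?mul0r.
Qed.

Variable W : {vspace 'cV[C]_n}.

Lemma T_module_of_stable :
  (forall i, stable (E i) W) -> (forall i, stable (Es i) W) -> T_module Y x W.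
Proof.
move=> WE WEs B v TB; elim: TB v => {B}.
- move=> B /(bose_mesner_idemP Eprim)[c ->] v vW; rewrite mulmx_suml.
  by apply: memv_suml => i _; rewrite -scalemxAl memvZ ?WE.
- move=> B /span_imageP[c ->] v vW; rewrite mulmx_suml.
  by apply: memv_suml => i _; rewrite -scalemxAl memvZ ?WEs.
- by move=> B1 B2 _ IH1 _ IH2 v vW; rewrite mulmxDl memvD ?IH1 ?IH2.
- by move=> k B _ IH v vW; rewrite -scalemxAl memvZ ?IH.
- by move=> B1 B2 _ IH1 _ IH2 v vW; rewrite -mulmxA IH1 ?IH2.
Qed.

Hypothesis WT : T_module Y x W.

Lemma T_module_adj : stable A W.
Proof. by move=> w; apply: WT; apply: Terw_M; apply: assoc_in. Qed.

Lemma T_module_dual_idem i : stable (Es i) W.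
Proof.
move=> w; apply: WT; apply: Terw_Mstar; apply: memv_span.
by apply: map_f; rewrite mem_enum.
Qed.

End DualSide.

(** * The tridiagonal relation *)

Section ExtendedIndex.
Variables (C : fieldType) (X : finType) (D : nat).
Local Notation n := #|X|.
Variable F : 'I_D.+1 -> 'M[C]_n.
Hypothesis resF : resolution F.
Local Notation Fx := (idem_ext F).

Lemma idem_ext_ord (i : 'I_D.+1) : Fx i%:Z = F i.
Proof. by rewrite /idem_ext valK. Qed.

(** Integer indices let identities between neighbouring levels hold uniformly: at the boundary the
    missing terms are zero. *)
Variant idem_ext_spec (k : int) : 'M[C]_n -> Prop :=
| IdemExtIn i of k = (nat_of_ord i)%:Z : idem_ext_spec k (F i)
| IdemExtOut of (k < 0) || (D%:Z < k) : idem_ext_spec k 0.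

Lemma idem_extP k : idem_ext_spec k (Fx k).
Proof.
case: k => m /=; last by apply: IdemExtOut.
case: insubP => [i _ <-|]; first exact: IdemExtIn.
by rewrite -leqNgt => Dm; apply: IdemExtOut; rewrite ltz_nat Dm orbT.
Qed.

Lemma idem_ext_mul k l m (w : 'M_(n, m)) :
  Fx k *m (Fx l *m w) = if k == l then Fx k *m w else 0.
Proof.
case: (idem_extP k) => [i ->|ko].
  case: (idem_extP l) => [j ->|lo]; first by rewrite resolution_mul.
  rewrite mul0mx mulmx0; case: eqP => // il; exfalso.
  by have := ltn_ord i; move: lo; rewrite -il; lia.
by rewrite !mul0mx if_same.
Qed.

Lemma idem_extK k m (w : 'M_(n, m)) : Fx k *m (Fx k *m w) = Fx k *m w.
Proof. by rewrite idem_ext_mul eqxx. Qed.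

Lemma idem_ext_inj (v w : 'cV[C]_n) :
  (forall k, Fx k *m v = Fx k *m w) -> v = w.
Proof.
move=> eqF; rewrite (resolution_sum resF v) (resolution_sum resF w).
by apply: eq_bigr => i _; rewrite -idem_ext_ord eqF.
Qed.

Lemma idem_ext_ind (P : 'cV[C]_n -> Prop) :
  P 0 -> (forall v w, P v -> P w -> P (v + w)) -> (forall k w, P (Fx k *m w)) ->
  forall w, P w.
Proof.
move=> P0 Padd PF w; rewrite (resolution_sum resF w).
by apply: big_ind => // i _; rewrite -idem_ext_ord.
Qed.

Lemma idem_ext_stable (U : {vspace 'cV[C]_n}) :
  (forall i, stable (F i) U) -> forall k, stable (Fx k) U.
Proof.
by move=> FU k w wU; case: (idem_extP k) => [i _|_];
  rewrite ?FU // mul0mx mem0v.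
Qed.

Section Tridiagonal.
Variable B : 'M[C]_n.
Hypothesis Bfar : forall i j : 'I_D.+1, (i.+1 < j)%N || (j.+1 < i)%N ->
  F i *m B *m F j = 0.

Lemma tridiag_far (k l : int) (w : 'cV_n) : (k + 1 < l) || (l + 1 < k) ->
  Fx k *m (B *m (Fx l *m w)) = 0.
Proof.
case: (idem_extP k) => [i ->|_]; last by rewrite mul0mx.
case: (idem_extP l) => [j ->|_]; last by rewrite mul0mx !mulmx0.
by move=> far; rewrite !mulmxA Bfar ?mul0mx //; lia.
Qed.

(** The three terms are the lowering, flat and raising parts of [B] on level [k]; any other
    component is a far block. *)
Lemma tridiag_col (k : int) (w : 'cV_n) : B *m (Fx k *m w) =
  Fx (k - 1) *m (B *m (Fx k *m w)) + Fx k *m (B *m (Fx k *m w))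
  + Fx (k + 1) *m (B *m (Fx k *m w)).
Proof.
apply: idem_ext_inj => l; rewrite !mulmxDr !idem_ext_mul.
have [->|nl1] := eqVneq l (k - 1).
  have -> : (k - 1 == k) = false by lia.
  have -> : (k - 1 == k + 1) = false by lia.
  by rewrite !addr0.
have [->|nl2] := eqVneq l k.
  have -> : (k == k + 1) = false by lia.
  by rewrite add0r addr0.
have [->|nl3] := eqVneq l (k + 1); first by rewrite !add0r.
by rewrite !addr0 tridiag_far //; lia.
Qed.

Lemma tridiag_row (k : int) (w : 'cV_n) : Fx k *m (B *m w) =
  Fx k *m (B *m (Fx (k - 1) *m w)) + Fx k *m (B *m (Fx k *m w))
  + Fx k *m (B *m (Fx (k + 1) *m w)).
Proof.
elim/idem_ext_ind: w => [|v w|l w]; first by rewrite !mulmx0 !addr0.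
  by rewrite !mulmxDr => -> ->; rewrite addrACA [X in X + _ = _]addrACA.
rewrite !idem_ext_mul.
have [<-|nl1] := eqVneq (k - 1) l.
  have -> : (k == k - 1) = false by lia.
  have -> : (k + 1 == k - 1) = false by lia.
  by rewrite !mulmx0 !addr0.
have [<-|nl2] := eqVneq k l.
  have -> : (k + 1 == k) = false by lia.
  by rewrite !mulmx0 add0r addr0.
have [<-|nl3] := eqVneq (k + 1) l; first by rewrite !mulmx0 !add0r.
by rewrite !mulmx0 !addr0 tridiag_far //; lia.
Qed.

End Tridiagonal.

(** The values of the formula [taux] outside [0, D] are harmless, because the idempotent is zero
    there. *)
Lemma idem_ext_eigen (B : 'M[C]_n) (tau : 'I_D.+1 -> C) (taux : int -> C) :
  (forall i, B *m F i = tau i *: F i) ->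
  (forall i : 'I_D.+1, tau i = taux i%:Z) ->
  forall k (w : 'cV_n), B *m (Fx k *m w) = taux k *: (Fx k *m w).
Proof.
move=> BF tauE k w; case: (idem_extP k) => [i ->|_].
  by rewrite mulmxA BF -scalemxAl tauE.
by rewrite mul0mx mulmx0 scaler0.
Qed.

Lemma idem_ext_eigenr (B : 'M[C]_n) (tau : 'I_D.+1 -> C) (taux : int -> C) :
  (forall i, B *m F i = tau i *: F i) ->
  (forall i : 'I_D.+1, tau i = taux i%:Z) ->
  forall k (w : 'cV_n), Fx k *m (B *m w) = taux k *: (Fx k *m w).
Proof.
move=> BF tauE k w; case: (idem_extP k) => [i ->|_].
  by rewrite mulmxA (resolution_eigenr resF BF) -scalemxAl tauE.
by rewrite !mul0mx scaler0.
Qed.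

Lemma dim_graded (a : 'I_D.+1 -> 'cV[C]_n) : (forall i, F i *m a i = a i) ->
  \dim (\sum_i <[a i]>)%VS = #|[set i | a i != 0]|.
Proof.
move=> Fa; have /directvP -> /= : directv (\sum_i <[a i]>)%VS.
  apply/directv_sum_independent => us usP sum0 i _.
  have Fus j : F j *m us j = us j.
    by have /vlineP[c ->] := usP j isT; rewrite -scalemxAr Fa.
  have := congr1 (mulmx (F i)) sum0; rewrite mulmx0 mulmx_sumr (bigD1 i) //=.
  rewrite Fus big1 ?addr0 // => j ji.
  by rewrite -Fus resolution_mul // eq_sym (negPf ji).
rewrite -sum1dep_card [RHS]big_mkcond; apply: eq_bigr => i _.
by rewrite dim_vline; case: (a i != 0).
Qed.

Lemma graded_proj (a : 'I_D.+1 -> 'cV[C]_n) i w :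
  (forall i, F i *m a i = a i) ->
  w \in (\sum_i <[a i]>)%VS -> F i *m w \in <[a i]>%VS.
Proof.
move=> Fa /memv_sumP[us usP ->]; rewrite mulmx_sumr; apply: memv_suml => j _.
have /vlineP[c ->] := usP j isT; rewrite -scalemxAr memvZ // -Fa.
rewrite resolution_mul //; case: eqP => [->|_]; last exact: mem0v.
by rewrite Fa memv_line.
Qed.

End ExtendedIndex.

(* Sandwiched between [E i] and [E j], the difference of the two sides becomes
   [E i As E j] times [theta i - theta j] times a quadratic expression in
   [theta i], [theta j] that vanishes at consecutive eigenvalues. *)
Lemma tridiagonal_relation (C : fieldType) (n D : nat) (B As : 'M[C]_n)
    (E : 'I_D.+1 -> 'M[C]_n) (theta : 'I_D.+1 -> C) (q u w : C) :
  resolution E -> (forall i, B *m E i = theta i *: E i) ->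
  (forall i j : 'I_D.+1, (i.+1 < j)%N || (j.+1 < i)%N ->
    E i *m As *m E j = 0) ->
  q != 0 -> (forall i : 'I_D.+1, theta i = u * q ^- i + w * q ^+ i) ->
  forall v : 'cV[C]_n,
  B *m (B *m (B *m (As *m v))) - As *m (B *m (B *m (B *m v)))
  + (q + 1 + q^-1) *: (B *m (As *m (B *m (B *m v)))
                       - B *m (B *m (As *m (B *m v))))
  = - (u * w * (q - q^-1) ^+ 2) *: (B *m (As *m v) - As *m (B *m v)).
Proof.
move=> resE BE far q0 thE v; set b := q + _ + _; set rho := - (u * _ * _).
have EB := resolution_eigenr resE BE.
have EBm i (z : 'cV_n) : E i *m (B *m z) = theta i *: (E i *m z).
  by rewrite mulmxA EB -scalemxAl.
have BEm i (z : 'cV_n) : B *m (E i *m z) = theta i *: (E i *m z).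
  by rewrite mulmxA BE -scalemxAl.
(* Both sides are fixed matrices applied to [v]. Their difference [M] vanishes as soon as every
   block [E i *m M *m E j] does. *)
pose M : 'M_n := B *m B *m B *m As - As *m B *m B *m B
   + b *: (B *m As *m B *m B - B *m B *m As *m B) - rho *: (B *m As - As *m B).
suff M0 : M = 0.
  apply/eqP; rewrite -subr_eq0; apply/eqP.
  transitivity (M *m v); last by rewrite M0 mul0mx.
  by rewrite /M !(mulmxDl, mulNmx, =^~ scalemxAl) -!mulmxA.
have EME i j (z : 'cV_n) : E i *m (M *m (E j *m z)) = 0.
  rewrite /M !(mulmxDl, mulNmx, =^~ scalemxAl) -!mulmxA.
  rewrite !(mulmxDr, mulmxN, =^~ scalemxAr, EBm, BEm).
  have EAsE : E i *m (As *m (E j *m z)) = (E i *m As *m E j) *m z.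
    by rewrite !mulmxA.
  have quad (k l : 'I_D.+1) : l = k.+1 :> nat ->
      theta k ^+ 2 - (q + q^-1) * theta k * theta l + theta l ^+ 2 = rho.
    move=> lk; rewrite !thE lk !(exprS q k) /rho; have := expf_neq0 k q0.
    move: (q ^+ k) => a a0. field; rewrite a0 q0; exact: isT.
  set S := E i *m (As *m (E j *m z)) in EAsE *.
  transitivity ((theta i - theta j) * (theta i ^+ 2
     - (q + q^-1) * theta i * theta j + theta j ^+ 2 - rho) *: S).
    by apply/colP => y; rewrite /b !mxE; ring.
  have [lt_ij|] := boolP ((i.+1 < j)%N || (j.+1 < i)%N).
    by rewrite EAsE far // mul0mx scaler0.
  rewrite negb_or -!leqNgt => /andP[le_ij le_ji].
  have [eij|nij] := eqVneq i j; first by rewrite eij subrr mul0r scale0r.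
  have {}nij : nat_of_ord i != j by [].
  have [lt_ij|le_ij'] := ltnP i j.
    by rewrite quad ?subrr ?mulr0 ?scale0r //; lia.
  have -> : theta i ^+ 2 - (q + q^-1) * theta i * theta j + theta j ^+ 2
    = theta j ^+ 2 - (q + q^-1) * theta j * theta i + theta i ^+ 2 by ring.
  by rewrite quad ?subrr ?mulr0 ?scale0r //; lia.
apply/matrixP => y z; rewrite -[M]mulmx1 -[M *m _]mul1mx -resE.2.
rewrite !mulmx_sumr summxE big1 ?mxE // => j _.
rewrite mulmx_suml summxE big1 // => i _.
have := EME i j (delta_mx z 0) => /colP/(_ y).
by rewrite !mulmxA -colE !mxE.
Qed.

(* The closed forms of theta_i (whose additive constant turns out to vanish) and
   of theta*_i, at an arbitrary integer index. *)
Definition eigval (F : unitRingType) (q s h : F) (k : int) : F :=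
  h * (q ^ k)^-1 + h * s * q * q ^ k.
Definition dual_eigval (F : unitRingType) (D : nat) (q hs c : F) (k : int) :
    F :=
  c + hs * ((q ^ k)^-1 + q ^ k / q ^+ (2 * D + 1)).

(** * Irreducible modules *)

Lemma card_ord_geq (D : nat) (r : 'I_D.+1) :
  #|[set i : 'I_D.+1 | (r <= i)%N]| = (D - r).+1.
Proof.
rewrite -sum1dep_card (reindex_inj rev_ord_inj) /=.
rewrite (eq_bigl (fun i : 'I_D.+1 => i < (D - r).+1)%N) => [|i]; last first.
  by have := ltn_ord i; have := ltn_ord r; lia.
by rewrite -(big_ord_widen _ (fun=> 1%N)) ?sum1_card ?card_ord //; lia.
Qed.

Section System.
Variables (C : numClosedFieldType) (X : finType) (D : nat).
Local Notation n := #|X|.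
Variables (A As : 'M[C]_n) (E Es : 'I_D.+1 -> 'M[C]_n).
Variables (theta thetas : 'I_D.+1 -> C) (q s h hs c : C).
Hypothesis resE : resolution E.
Hypothesis resEs : resolution Es.
Hypothesis AE : forall i, A *m E i = theta i *: E i.
Hypothesis AsEs : forall i, As *m Es i = thetas i *: Es i.
Hypothesis theta_inj : injective theta.
Hypothesis thetas_inj : injective thetas.
Hypothesis EAsE : forall i j : 'I_D.+1, (i.+1 < j)%N || (j.+1 < i)%N ->
  E i *m As *m E j = 0.
Hypothesis EsAEs : forall i j : 'I_D.+1, (i.+1 < j)%N || (j.+1 < i)%N ->
  Es i *m A *m Es j = 0.
Hypothesis EsAEs_flat : forall i : 'I_D.+1, (i < D)%N -> Es i *m A *m Es i = 0.
Hypothesis q_neq0 : q != 0.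
Hypothesis hs_neq0 : hs != 0.
Hypothesis thetaE : forall i : 'I_D.+1,
  theta i = h * q ^- i + h * s * q * q ^+ i.
Hypothesis thetasE : forall i : 'I_D.+1,
  thetas i = c + hs * (q ^- i + q ^+ i / q ^+ (2 * D + 1)).
Hypothesis q_root : forall k, (0 < k <= 2 * D)%N -> q ^+ k != 1.
Hypothesis h_neq0 : h != 0.
Hypothesis sq_neq : forall k, (0 < k <= 2 * D + 1)%N -> s * q ^+ k != -1.
Hypothesis D_gt2 : (2 < D)%N.

Local Notation Ex := (idem_ext E).
Local Notation Esx := (idem_ext Es).

Local Notation thetax := (eigval q s h).
Local Notation taux := (dual_eigval D q hs c).

Lemma ExA k (w : 'cV_n) : Ex k *m (A *m w) = thetax k *: (Ex k *m w).
Proof.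
by apply: (idem_ext_eigenr resE AE) => i; rewrite thetaE /eigval.
Qed.

Lemma AsEsx k (w : 'cV_n) : As *m (Esx k *m w) = taux k *: (Esx k *m w).
Proof.
by apply: (idem_ext_eigen AsEs) => i; rewrite thetasE /dual_eigval.
Qed.

Lemma EsxAs k (w : 'cV_n) : Esx k *m (As *m w) = taux k *: (Esx k *m w).
Proof.
by apply: (idem_ext_eigenr resEs AsEs) => i;
  rewrite thetasE /dual_eigval.
Qed.

Lemma Esx_flat (k : int) (w : 'cV_n) : k != D%:Z ->
  Esx k *m (A *m (Esx k *m w)) = 0.
Proof.
case: idem_extP => [i -> iD|_ _]; last by rewrite !mul0mx.
rewrite !mulmxA EsAEs_flat ?mul0mx //.
by rewrite ltn_neqAle -ltnS ltn_ord andbT; move: iD; rewrite eqz_nat.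
Qed.

Lemma A_relation (v : 'cV_n) :
  A *m (A *m (A *m (As *m v))) - As *m (A *m (A *m (A *m v)))
  + (q + 1 + q^-1) *: (A *m (As *m (A *m (A *m v)))
                       - A *m (A *m (As *m (A *m v))))
  = - (h * (h * s * q) * (q - q^-1) ^+ 2) *: (A *m (As *m v) - As *m (A *m v)).
Proof. exact: (tridiagonal_relation resE AE EAsE q_neq0 thetaE). Qed.

Lemma taux_nat (k : nat) :
  taux k = c + hs * (q ^- k + q ^+ k / q ^+ (2 * D + 1)).
Proof. by []. Qed.

(** This is the coefficient of the unknown vector in [descent_step]. It is a multiple of (q^2 -
    1)(q^k - 1) with k = 2D + 1 - 2m, and the bounds on [m] keep k between 1 and 2D. *)
Lemma tau_descent_neq0 (m : int) : 0 < m -> m + 2 <= D%:Z ->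
  taux (m + 2) - taux (m + 1) + (q + 1 + q^-1) * (taux m - taux (m + 1)) != 0.
Proof.
case: m => // m m0 mD; have {}m0 : (0 < m)%N by [].
rewrite -!PoszD !taux_nat.
pose k := (2 * D + 1 - 2 * m)%N.
have -> : (2 * D + 1 = k + m + m)%N by rewrite /k; lia.
have [k0 a0] : q ^+ k != 0 /\ q ^+ m != 0 by rewrite !expf_neq0.
rewrite !exprD; set a := q ^+ m in a0 *; set b := q ^+ k in k0 *.
have -> : c + hs * ((a * q ^+ 2)^-1 + a * q ^+ 2 / (b * a * a))
    - (c + hs * ((a * q ^+ 1)^-1 + a * q ^+ 1 / (b * a * a)))
    + (q + 1 + q^-1) * (c + hs * (a^-1 + a / (b * a * a))
      - (c + hs * ((a * q ^+ 1)^-1 + a * q ^+ 1 / (b * a * a))))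
    = hs * (q ^+ 2 - 1) * (b - 1) / (q * a * b).
  by field; rewrite q_neq0 a0 k0.
rewrite !mulf_neq0 ?invr_neq0 ?mulf_neq0 //.
  by rewrite subr_eq0 q_root //; lia.
by rewrite subr_eq0 q_root // /k; lia.
Qed.

(** Here [g], [g1], [g2] lie on the levels m + 2, m + 1, m, and [p] is the part of [A *m g] that is
    not lowered. In the block of the tridiagonal relation from [g] to level m + 1, the raised vector
    of [g2] is the only unknown; all other words give multiples of [g1]. Keeping [p] abstract covers
    both the flat part at the top and a raised vector lower down. *)
Lemma descent_step (m : int) (g g1 g2 p p2 : 'cV_n)
    (sigma sigma2 y alpha delta eps : C) :
  0 < m -> m + 2 <= D%:Z ->
  Esx m *m g2 = g2 -> Esx (m + 1) *m g1 = g1 -> Esx (m + 2) *m g = g ->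
  A *m g = g1 + p -> As *m p = sigma *: p -> Esx (m + 1) *m p = 0 ->
  A *m g1 = g2 + y *: g -> A *m p = alpha *: g + delta *: g1 + p2 ->
  As *m p2 = sigma2 *: p2 -> Esx (m + 1) *m (A *m p2) = eps *: g1 ->
  exists y', Esx (m + 1) *m (A *m g2) = y' *: g1.
Proof.
move=> m0 mD Eg2 Eg1 Eg Ag Asp Ep Ag1 Ap Asp2 EAp2.
have Asg2 : As *m g2 = taux m *: g2 by rewrite -Eg2 AsEsx.
have Asg1 : As *m g1 = taux (m + 1) *: g1 by rewrite -Eg1 AsEsx.
have Asg : As *m g = taux (m + 2) *: g by rewrite -Eg AsEsx.
have EAg1 : Esx (m + 1) *m (A *m g1) = 0 by rewrite -Eg1 Esx_flat //; lia.
have Eg0 : Esx (m + 1) *m g = 0.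
  by rewrite -Eg (idem_ext_mul resEs); case: eqP => //; lia.
have Eg20 : Esx (m + 1) *m g2 = 0.
  by rewrite -Eg2 (idem_ext_mul resEs); case: eqP => //; lia.
have EAg : Esx (m + 1) *m (A *m g) = g1 by rewrite Ag mulmxDr Eg1 Ep addr0.
have := congr1 (mulmx (Esx (m + 1))) (A_relation g).
rewrite !(mulmxDr, mulmxN, =^~ scalemxAr, EsxAs, Asg, EAg).
rewrite !(Ag, Ag1, Ap, Asp, Asp2, Asg, Asg1, Asg2, mulmxDr, EAg, EAg1, EAp2,
          Eg1, Ep, Eg0, Eg20, =^~ scalemxAr).
move: (tau_descent_neq0 m0 mD); set K := taux _ - _ + _ => K0.
move: (Esx (m + 1) *m (A *m g2)) => z.
set b := q + 1 + q^-1; set rho := - (_ * _ * _) => zE.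
exists (K^-1 * ((rho - (y + alpha + eps)) * (taux (m + 2) - taux (m + 1))
  - b * (y * taux (m + 2) + alpha * taux (m + 2) + sigma2 * eps
         - taux (m + 1) * y - sigma * (alpha + eps)))).
rewrite -scalerA; apply: (canRL (scalerK K0)).
apply/eqP; rewrite -subr_eq0; apply/eqP; move/eqP: zE; rewrite -subr_eq0.
move=> /eqP zE; rewrite -zE /K /b.
by apply/colP => i; rewrite !mxE; ring.
Qed.

Variable W : {vspace 'cV[C]_n}.
Hypothesis AW : stable A W.
Hypothesis EsW : forall i, stable (Es i) W.
Hypothesis W_neq0 : W <> 0%VS.
Hypothesis W_irr : forall U, stable A U -> (forall i, stable (Es i) U) ->
  (U <= W)%VS -> U = 0%VS \/ U = W.

Lemma stable_E U : stable A U -> forall i, stable (E i) U.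
Proof. exact: stable_resolution. Qed.

Lemma stable_As U : (forall i, stable (Es i) U) -> stable As U.
Proof.
move=> EsU w wU; rewrite (resolution_sum resEs w) mulmx_sumr.
by apply: memv_suml => i _; rewrite mulmxA AsEs -scalemxAl memvZ ?EsU.
Qed.

Lemma stable_A U : (forall i, stable (E i) U) -> stable A U.
Proof.
move=> EU w wU; rewrite (resolution_sum resE w) mulmx_sumr.
by apply: memv_suml => i _; rewrite mulmxA AE -scalemxAl memvZ ?EU.
Qed.

(* On [E*_D], where [A] is not bipartite, the flat part of [A] commutes with the
   composite [R L] of its raising and lowering parts. *)
Lemma flat_comm (w : 'cV_n) : Esx D *m w = w ->
  Esx D *m (A *m (Esx (D%:Z - 1) *m (A *m (Esx D *m (A *m w)))))
  = Esx D *m (A *m (Esx D *m (A *m (Esx (D%:Z - 1) *m (A *m w))))).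
Proof.
move=> Ew.
have Asw : As *m w = taux D *: w by rewrite -Ew AsEsx.
have D1 : Esx (D%:Z + 1) = 0.
  by case: idem_extP => // i; have := ltn_ord i; lia.
have ADw (u : 'cV_n) : Esx D *m u = u ->
    A *m u = Esx (D%:Z - 1) *m (A *m u) + Esx D *m (A *m u).
  move=> Eu; rewrite -{1}Eu.
  by rewrite (tridiag_col resEs EsAEs) D1 mul0mx addr0 Eu.
have flat1 (u : 'cV_n) : Esx (D%:Z - 1) *m (A *m (Esx (D%:Z - 1) *m u)) = 0.
  by rewrite Esx_flat //; lia.
have rowD (u : 'cV_n) : Esx D *m (A *m u)
    = Esx D *m (A *m (Esx (D%:Z - 1) *m u)) + Esx D *m (A *m (Esx D *m u)).
  by rewrite (tridiag_row resEs EsAEs) D1 mul0mx !mulmx0 addr0.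
have row1 (u : 'cV_n) : Esx (D%:Z - 1) *m (A *m (Esx D *m u))
    = Esx (D%:Z - 1) *m (A *m (Esx (D%:Z - 1) *m u + Esx D *m u)).
  by rewrite mulmxDr mulmxDr flat1 add0r.
have := congr1 (mulmx (Esx D)) (A_relation w).
set l := Esx (D%:Z - 1) *m (A *m w); set a := Esx D *m (A *m w).
have Aw : A *m w = l + a by exact: ADw.
have AsAw : As *m (A *m w) = taux (D%:Z - 1) *: l + taux D *: a.
  by rewrite Aw mulmxDr !AsEsx.
have fl : Esx (D%:Z - 1) *m (A *m l) = 0 by rewrite flat1.
have El : Esx D *m l = 0.
  by rewrite (idem_ext_mul resEs); case: eqP => //; lia.
have Ea : Esx D *m a = a by rewrite (idem_extK resEs).
rewrite !(mulmxDr, mulmxN, =^~ scalemxAr) (rowD (As *m _)) Asw AsAw !EsxAs.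
rewrite !(Aw, mulmxDr, mulmxN, =^~ scalemxAr) El Ea fl.
rewrite add0r scaler0 add0r subrr.
rewrite !(rowD (A *m l)) !(rowD (A *m a)) fl !mulmx0 !add0r subrr scaler0.
set t1 := Esx D *m (A *m (Esx (D%:Z - 1) *m (A *m a))).
set t2 := Esx D *m (A *m (Esx D *m (A *m l))).
set t3 := Esx D *m (A *m (Esx D *m (A *m a))).
(* The block has collapsed to (q + 1 + 1/q)(theta*_{D-1} - theta*_D)(t1 - t2) = 0. The first factor
   vanishes only if q^3 = 1, the second only if two dual eigenvalues coincide. *)
move=> /eqP; rewrite scaler_eq0 => /orP[/eqP b0|].
  exfalso; have /eqP[] : q ^+ 3 != 1 by apply: q_root; lia.
  have -> : q ^+ 3 = (q + 1 + q^-1) * (q * (q - 1)) + 1 by field.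
  by rewrite b0 mul0r add0r.
have -> : taux (D%:Z - 1) *: t1 + taux D *: (t2 + t3)
    - (taux (D%:Z - 1) *: t2 + taux D *: (t1 + t3))
    = (taux (D%:Z - 1) - taux D) *: (t1 - t2).
  by apply/colP => i; rewrite !mxE; ring.
rewrite scaler_eq0 subr_eq0 => /orP[/eqP e|]; last by rewrite subr_eq0 => /eqP.
exfalso; have D1D : (D.-1 < D.+1)%N by lia.
suff : Ordinal D1D = ord_max by move=> /(congr1 val) /=; lia.
apply: thetas_inj; rewrite !thetasE -!taux_nat /=.
by have -> : D.-1%:Z = D%:Z - 1 by lia.
Qed.

(** The sum theta_i + theta_j factors as h (q^i + q^j)(1 + s q^(i+j+1)) / q^(i+j). A zero of q^i +
    q^j with i < j would give q^(2(j-i)) = 1. *)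
Lemma theta_opp_neq (i j : 'I_D.+1) : theta j != - theta i.
Proof.
rewrite -subr_eq0 opprK !thetaE.
have [qi0 qj0] : q ^+ i != 0 /\ q ^+ j != 0 by rewrite !expf_neq0.
have -> : h / q ^+ j + h * s * q * q ^+ j + (h / q ^+ i + h * s * q * q ^+ i)
   = h * (q ^+ i + q ^+ j) * (1 + s * q ^+ (i + j).+1) / (q ^+ i * q ^+ j).
  rewrite exprS exprD; field; rewrite qi0 qj0; exact: isT.
rewrite !mulf_neq0 ?invr_neq0 ?mulf_neq0 //; last first.
  rewrite addrC addr_eq0 sq_neq //.
  by have := ltn_ord i; have := ltn_ord j; lia.
wlog le_ij : i j {qi0 qj0} / (i <= j)%N => [wl|].
  by case: (leqP i j) => [|/ltnW] /wl //; rewrite addrC.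
have [eij|nij] := eqVneq (nat_of_ord i) j.
  by rewrite eij -mulr2n mulrn_eq0 expf_neq0.
apply/negP => /eqP qij0.
have : q ^+ (2 * (j - i)) != 1.
  by rewrite q_root //; have := ltn_ord j; lia.
have qD : q ^+ (j - i) * q ^+ i = q ^+ j by rewrite -exprD subnK.
have q1 : q ^+ (j - i) = -1.
  apply: (mulIf (expf_neq0 i q_neq0)); rewrite qD mulN1r.
  by apply/eqP; rewrite -addr_eq0 addrC qij0.
by rewrite mulnC exprM q1 sqrrN expr1n eqxx.
Qed.

Lemma top_neq0 : exists2 w, w \in W & Esx D *m w != 0.
Proof.
have [|/eqP/mx_img_neq0[w wW w0]] := altP (@eqP _ (mx_img (Es ord_max) W) 0%VS);
  last by exists w; rewrite // -(idem_ext_ord Es ord_max) in w0.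
move/mx_img_eq0P => top0; exfalso.
have {}top0 w : w \in W -> Esx D *m w = 0.
  by move=> /top0; rewrite -idem_ext_ord.
have [i [w0 [w0W w0n Ew0]]] : exists i w, [/\ w \in W, w != 0 & E i *m w = w].
  have: vpick W != 0 by rewrite vpick0; apply/eqP.
  rewrite {1}(resolution_sum resE (vpick W)) => nz.
  have [i Ei|allE0] := pickP (fun i => E i *m vpick W != 0).
    exists i, (E i *m vpick W).
    split=> //; last by rewrite resolution_mul ?eqxx.
    by apply: stable_E AW _ _ (memv_pick W).
  case/eqP: nz; apply: big1 => j _; apply/eqP; exact: negbFE (allE0 j).
(* [S] multiplies level k by (-1)^k. Since A has no flat part on W when the top level is empty, [S]
   turns the eigenvector [w0] for theta_i into one for - theta_i. *)
pose S (w : 'cV_n) := \sum_(k < D.+1) (-1) ^+ k *: (Es k *m w) : 'cV_n.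
have ES (k : int) w : Esx k *m S w = (-1) ^ k *: (Esx k *m w).
  case: idem_extP => [l ->|_]; last by rewrite !mul0mx scaler0.
  rewrite mulmx_sumr (bigD1 l) //= -scalemxAr resolution_mul // eqxx.
  rewrite big1 ?addr0 // => j jl.
  by rewrite -scalemxAr resolution_mul // eq_sym (negPf jl) scaler0.
have flat (k : int) (w : 'cV_n) : w \in W -> Esx k *m (A *m (Esx k *m w)) = 0.
  have [->|kD] := eqVneq k D%:Z; last by rewrite Esx_flat.
  by move=> wW; rewrite (top0 w wW) !mulmx0.
have AS : A *m S w0 = - S (A *m w0).
  apply: (idem_ext_inj resEs) => k; rewrite mulmxN ES.
  rewrite (tridiag_row resEs EsAEs) [in RHS](tridiag_row resEs EsAEs).
  rewrite !ES -!scalemxAr !flat // scaler0 !addr0.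
  rewrite !expfzDr ?oppr_eq0 ?oner_eq0 // exprN1 invrN1 expr1z !mulrN1.
  by rewrite !scaleNr -opprD -scalerDr.
have Aw0 : A *m w0 = theta i *: w0 by rewrite -Ew0 mulmxA AE -scalemxAl.
have ASw0 : A *m S w0 = - theta i *: S w0.
  rewrite AS Aw0 scaleNr /S scaler_sumr; congr (- _); apply: eq_bigr => k _.
  by rewrite -scalemxAr !scalerA mulrC.
have Sw0n : S w0 != 0.
  apply: contra w0n => /eqP Sw0; apply/eqP; apply: (idem_ext_inj resEs) => k.
  rewrite mulmx0; apply/eqP; have := ES k w0; rewrite Sw0 mulmx0 => /esym/eqP.
  by rewrite scaler_eq0 expfz_eq0 oppr_eq0 oner_eq0 andbF.
have [j Ej|allE0] := pickP (fun j => E j *m S w0 != 0); last first.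
  case/eqP: Sw0n; rewrite (resolution_sum resE (S w0)); apply: big1 => j _.
  by apply/eqP; exact: negbFE (allE0 j).
have /eqP := congr1 (mulmx (E j)) ASw0.
rewrite mulmxA (resolution_eigenr resE AE) -scalemxAl -scalemxAr -subr_eq0.
rewrite -scalerBl scaler_eq0 (negPf Ej) orbF subr_eq0.
by rewrite (negPf (theta_opp_neq i j)).
Qed.

(** The flat part F has an eigenvector in E*_D W. By [flat_comm] its eigenspace is stable under R L,
    which therefore has an eigenvector inside it. *)
Lemma top_vector : exists u f y, [/\ u \in W, u != 0, Esx D *m u = u,
  Esx D *m (A *m u) = f *: u
  & Esx D *m (A *m (Esx (D%:Z - 1) *m (A *m u))) = y *: u].
Proof.
have [w wW w0] := top_neq0.
have ExW k : stable (Esx k) W by apply: idem_ext_stable.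
pose U := mx_img (Esx D) W.
have UP v : v \in U -> v \in W /\ Esx D *m v = v.
  move=> /mem_mx_imgP[z zW ->]; rewrite (idem_extK resEs); split=> //.
  exact: ExW.
have UI v : v \in W -> Esx D *m v \in U.
  by move=> vW; apply/mem_mx_imgP; exists v.
have U0 : U <> 0%VS.
  by move=> U0; move: (UI _ wW); rewrite U0 memv0 (negPf w0).
have FU : stable (Esx D *m A) U.
  by move=> v /UP[vW _]; rewrite -mulmxA UI ?AW.
have [u [f [uU u0 Fu]]] := eigenvector_in_stable FU U0.
pose U1 := (U :&: lker (linfun (mulmx (Esx D *m A - f%:M))))%VS.
have U1P v : (v \in U1) = (v \in U) && (Esx D *m (A *m v) == f *: v).
  rewrite memv_cap memv_ker lfunE /= mulmxBl mul_scalar_mx subr_eq0.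
  by rewrite mulmxA.
have U1n : U1 <> 0%VS.
  move=> U10; have : u \in U1 by rewrite U1P uU mulmxA Fu eqxx.
  by rewrite U10 memv0 (negPf u0).
have KU1 : stable (Esx D *m A *m Esx (D%:Z - 1) *m A) U1.
  move=> v; rewrite !U1P -!mulmxA => /andP[/UP[vW Ev] /eqP Fv].
  rewrite UI ?AW ?ExW ?AW //= -flat_comm // Fv.
  by rewrite -!scalemxAr.
have [v [y [vU1 v0 Kv]]] := eigenvector_in_stable KU1 U1n.
move: vU1; rewrite U1P => /andP[/UP[vW Ev] /eqP Fv].
by exists v, f, y; split=> //; rewrite -Kv -!mulmxA.
Qed.

(** [chain u j] is L^j u, where L is the lowering part of A and [u] lies on level D. *)
Fixpoint chain (u : 'cV[C]_n) (j : nat) : 'cV[C]_n :=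
  if j is j'.+1 then Esx (D%:Z - j%:Z) *m (A *m chain u j') else u.


Section Chain.
Variables (u : 'cV[C]_n) (f y : C).
Hypothesis uW : u \in W.
Hypothesis u_neq0 : u != 0.
Hypothesis Eu : Esx D *m u = u.
Hypothesis Fu : Esx D *m (A *m u) = f *: u.
Hypothesis Ku : Esx D *m (A *m (Esx (D%:Z - 1) *m (A *m u))) = y *: u.
Hypothesis bot0 : forall w, w \in W -> Esx 0 *m w = 0.

Lemma chain_in j : chain u j \in W.
Proof.
elim: j => //= j IH; apply: (idem_ext_stable EsW).
exact: AW.
Qed.

Lemma chain_level j : Esx (D%:Z - j%:Z) *m chain u j = chain u j.
Proof.
case: j => [|j]; last by rewrite (idem_extK resEs).
by have -> : D%:Z - 0%N%:Z = D by lia.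
Qed.

(** By [bot0] level 0 of W is empty, so the chain is exhausted at index D already, not only at D +
    1. *)
Lemma chain_out j : (D <= j)%N -> chain u j = 0.
Proof.
rewrite leq_eqVlt => /orP[/eqP <-|Dj].
  by rewrite -chain_level subrr bot0 // chain_in.
rewrite -chain_level; case: idem_extP => [i|_]; last by rewrite mul0mx.
by lia.
Qed.

Lemma chain_proj k j :
  Esx k *m chain u j = if k == D%:Z - j%:Z then chain u j else 0.
Proof.
by rewrite -chain_level (idem_ext_mul resEs); case: eqP => // ->.
Qed.

Lemma top_out : Esx (D%:Z + 1) = 0.
Proof. by case: idem_extP => // i; have := ltn_ord i; lia. Qed.

(* Since [theta*_{D+1} = theta*_D], the chain behaves as if it went on above [D]
   with [chain u (-1) = chain u 0]; this is why the truncated [j.-1] is the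
   right index. *)
Lemma chain_three_term j :
  exists z, A *m chain u j = chain u j.+1 + z *: chain u j.-1.
Proof.
pose P j := exists z, A *m chain u j = chain u j.+1 + z *: chain u j.-1.
(* A descent step consumes the relations at three consecutive indices, so the induction carries all
   three. *)
suff : [/\ P j.-1, P j & P j.+1] by case.
elim: j => [|j [Pj [z0 P0] [z1 P1]]].
  have P0 : P 0%N.
    exists f; rewrite -[in LHS]Eu (tridiag_col resEs EsAEs) Eu Fu top_out.
    by rewrite mul0mx addr0.
  split=> //; exists y; rewrite -[chain u 1]chain_level.
  rewrite (tridiag_col resEs EsAEs) [in LHS]chain_level Esx_flat; last by lia.
  have -> : D%:Z - 1%N%:Z - 1 = D%:Z - 2%N%:Z by lia.
  have -> : D%:Z - 1%N%:Z + 1 = D by lia.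
  by rewrite addr0; congr (_ + _); exact: Ku.
split; [by exists z0|by exists z1|].
have [Dj|jD] := leqP D j.+2.
  exists 0; rewrite scale0r addr0 [RHS]chain_out ?[chain u j.+2]chain_out //.
    by rewrite mulmx0.
  exact: leqW.
suff [z2 P2] : exists z2, Esx (D%:Z - j.+1%:Z) *m (A *m chain u j.+2)
    = z2 *: chain u j.+1.
  exists z2; rewrite -P2.
  have := tridiag_col resEs EsAEs (D%:Z - j.+2%:Z) (chain u j.+2).
  rewrite Esx_flat ?chain_level; last by lia.
  have -> : D%:Z - j.+2%:Z - 1 = D%:Z - j.+3%:Z by lia.
  have -> : D%:Z - j.+2%:Z + 1 = D%:Z - j.+1%:Z by lia.
  by rewrite addr0.
have Esx1 : D%:Z - j.+1%:Z = (D%:Z - j.+2%:Z) + 1 by lia.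
have Esx2 : D%:Z - j%:Z = (D%:Z - j.+2%:Z) + 2 by lia.
rewrite Esx1.
have lvl (k : nat) (z : 'cV_n) : z = chain u k ->
    As *m z = taux (D%:Z - k%:Z) *: z.
  by move=> ->; rewrite -chain_level AsEsx.
(* At the top the remainder [p] is the flat part of [A *m u], which stays on level D and contributes
   through [delta] and [eps]. Below the top it is the raised vector, contributing through [alpha];
   its own remainder [p2] is then too high to reach the level of [g1]. *)
case: j => [|j] in Pj z0 P0 z1 P1 jD Esx1 Esx2 *.
  apply: (@descent_step (D%:Z - 2%N%:Z) (chain u 0) (chain u 1) (chain u 2)
            (z0 *: chain u 0) (z0 ^+ 2 *: chain u 0) (taux D) (taux D) z1 0 z0
            (z0 ^+ 2)).
  - by lia.
  - by lia.
  - exact: chain_level.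
  - by rewrite -Esx1 chain_level.
  - by rewrite -Esx2 chain_level.
  - exact: P0.
  - by rewrite -scalemxAr (lvl 0%N) // subr0 !scalerA mulrC.
  - rewrite -Esx1 -scalemxAr chain_proj.
    by case: eqP => //; [lia|rewrite scaler0].
  - exact: P1.
  - by rewrite -scalemxAr P0 scale0r add0r scalerDr scalerA expr2.
  - by rewrite -scalemxAr (lvl 0%N) // subr0 !scalerA mulrC.
  - rewrite -!scalemxAr P0 mulmxDr -Esx1 chain_level -scalemxAr chain_proj.
    by case: eqP => [|_]; [lia|rewrite /= scaler0 addr0].
have [z0' P0'] := Pj.
apply: (@descent_step (D%:Z - j.+3%:Z) (chain u j.+1) (chain u j.+2)
          (chain u j.+3) (z0 *: chain u j) ((z0 * z0') *: chain u j.-1)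
          (taux (D%:Z - j%:Z)) (taux (D%:Z - j.-1%:Z)) z1 z0 0 0).
- by lia.
- by lia.
- exact: chain_level.
- by rewrite -Esx1 chain_level.
- by rewrite -Esx2 chain_level.
- exact: P0.
- by rewrite -scalemxAr (lvl j) // !scalerA mulrC.
- rewrite -Esx1 -scalemxAr chain_proj.
  by case: eqP => //; [lia|rewrite scaler0].
- exact: P1.
- by rewrite -scalemxAr P0' scale0r addr0 scalerDr scalerA.
- by rewrite -scalemxAr (lvl j.-1) // !scalerA mulrC.
- rewrite -!scalemxAr -[chain u j.-1]chain_level -Esx1.
  rewrite (tridiag_far EsAEs) ?scaler0 ?scale0r //.
  by lia.
Qed.


(** Tails of the chain. A tail stable under A is a submodule, so irreducibility leaves only 0 and
    W. *)
Definition chain_span (j : nat) : {vspace 'cV[C]_n} :=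
  (\sum_(i < D.+1 | (j <= i)%N) <[chain u i]>)%VS.

Lemma mem_chain_span j k : (j <= k)%N -> chain u k \in chain_span j.
Proof.
move=> jk; have [kD|Dk] := ltnP k D.+1; last first.
  by rewrite chain_out ?mem0v // ltnW.
rewrite /chain_span (bigD1 (Ordinal kD)) //=.
by apply: subvP (addvSl _ _) _ _; apply: memv_line.
Qed.

Lemma chain_span_ind j (B : 'M_n) (U : {vspace 'cV[C]_n}) :
  (forall k, (j <= k)%N -> B *m chain u k \in U) ->
  forall w, w \in chain_span j -> B *m w \in U.
Proof.
move=> BU w /memv_sumP[us usP ->]; rewrite mulmx_sumr.
apply: memv_suml => i ji; have /vlineP[k ->] := usP i ji.
by rewrite -scalemxAr memvZ // BU.
Qed.

Lemma chain_span_Es j : forall i, stable (Es i) (chain_span j).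
Proof.
move=> i; apply: chain_span_ind => k jk; rewrite -idem_ext_ord chain_proj.
by case: eqP => _; rewrite ?mem0v ?mem_chain_span.
Qed.

Lemma chain_span_A j : A *m chain u j \in chain_span j ->
  stable A (chain_span j).
Proof.
move=> Aj; apply: chain_span_ind => k; rewrite leq_eqVlt => /orP[/eqP <- //|jk].
have [z ->] := chain_three_term k.
by rewrite memvD ?memvZ // mem_chain_span //; lia.
Qed.

Lemma chain_span_sub j : (chain_span j <= W)%VS.
Proof. by apply/subv_sumP => i _; rewrite -memvE chain_in. Qed.

Lemma chain_span0 : chain_span 0 = W.
Proof.
have [|U0|//] := W_irr _ (@chain_span_Es 0) (chain_span_sub 0).
  apply: chain_span_A; have [z ->] := chain_three_term 0.
  by rewrite memvD ?memvZ // mem_chain_span.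
by have := mem_chain_span (leqnn 0); rewrite U0 memv0 (negPf u_neq0).
Qed.

(** If the coefficient vanished, the tail starting at j + 1 would be stable and nonzero, hence all
    of W, although it has no component on level D. *)
Lemma chain_coef_neq0 j z : A *m chain u j.+1 = chain u j.+2 + z *: chain u j ->
  chain u j.+1 != 0 -> z != 0.
Proof.
move=> Aj cj0; apply/eqP => z0.
have [|U0|UW] := W_irr _ (@chain_span_Es j.+1) (chain_span_sub j.+1).
- by apply: chain_span_A; rewrite Aj z0 scale0r addr0 mem_chain_span.
- by have := mem_chain_span (leqnn j.+1); rewrite U0 memv0 (negPf cj0).
have : Esx D *m u \in 0%VS.
  apply: (@chain_span_ind j.+1); last by rewrite UW.
  by move=> k jk; rewrite chain_proj; case: eqP => [|_]; [lia|rewrite mem0v].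
by rewrite Eu memv0 (negPf u_neq0).
Qed.

Lemma chain_W_proj (i : 'I_D.+1) w : w \in W ->
  exists k, Es i *m w = k *: chain u (D - i).
Proof.
rewrite -chain_span0 => /memv_sumP[us usP ->]; rewrite mulmx_sumr.
have iD := ltn_ord i; have jD : (D - i < D.+1)%N by lia.
rewrite (bigD1 (Ordinal jD)) //= big1 ?addr0 => [|l li].
  have /vlineP[k ->] := usP (Ordinal jD) isT; exists k.
  rewrite -scalemxAr -idem_ext_ord chain_proj ifT //=; lia.
have /vlineP[k ->] := usP l isT.
rewrite -scalemxAr -idem_ext_ord chain_proj ifF ?scaler0 //.
have lD := ltn_ord l; apply: contraNF li => /eqP e.
by apply/eqP/val_inj => /=; lia.
Qed.

Variables (r : 'I_D.+1) (v : 'cV[C]_n).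
Hypothesis vW : v \in W.
Hypothesis v_neq0 : v != 0.
Hypothesis Erv : Es r *m v = v.
Hypothesis below0 : forall i : 'I_D.+1, (i < r)%N ->
  forall w, w \in W -> Es i *m w = 0.

(** Beyond D - r the chain would lie below the endpoint. It cannot stop earlier: once zero it stays
    zero, whereas [v] is a multiple of [chain u (D - r)]. *)
Lemma chain_neq0 j : (chain u j != 0) = (j <= D - r)%N.
Proof.
have [k def_v] := chain_W_proj r vW.
have zero j' : chain u j' = 0 -> forall l, chain u (j' + l) = 0.
  move=> c0; elim=> [|l IH]; first by rewrite addn0.
  by rewrite addnS /= IH !mulmx0.
apply/idP/idP => [cj|jr].
  rewrite leqNgt; apply: contra cj => rj.
  have [Dj|jD] := leqP D j; first by rewrite chain_out.
  have iD : (D - j < D.+1)%N by lia.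
  rewrite -chain_level; have -> : D%:Z - j%:Z = Ordinal iD by move=> /=; lia.
  by rewrite idem_ext_ord below0 ?chain_in //=; lia.
apply: contra v_neq0 => /eqP /zero /(_ (D - r - j)%N); rewrite subnKC // => c0.
by rewrite -Erv def_v c0 scaler0.
Qed.

Lemma dim_irreducible : \dim W = (D - r).+1.
Proof.
pose a (i : 'I_D.+1) := chain u (D - i).
have Ea i : Es i *m a i = a i.
  by rewrite -idem_ext_ord chain_proj ifT //; have := ltn_ord i; lia.
have <- : (\sum_i <[a i]>)%VS = W.
  rewrite -chain_span0 /chain_span (reindex_inj rev_ord_inj) /=.
  by apply: eq_big => // i _; rewrite /a /= subSS subKn // -ltnS.
rewrite (dim_graded resEs Ea) -card_ord_geq; apply: eq_card => i.
by rewrite !inE /a chain_neq0; have := ltn_ord i; have := ltn_ord r; lia.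
Qed.

Lemma level_neq0 (i : 'I_D.+1) : (mx_img (Es i) W != 0%VS) = (r <= i)%N.
Proof.
have [ir|ri] := ltnP i r.
  by apply: negbTE; rewrite negbK; apply/eqP/mx_img_eq0P; exact: below0.
apply/eqP => /mx_img_eq0P/(_ _ (chain_in (D - i))); rewrite -idem_ext_ord.
rewrite chain_proj ifT; last by have := ltn_ord i; lia.
by apply/eqP; rewrite chain_neq0; have := ltn_ord i; lia.
Qed.

Lemma diameter_irreducible :
  #|[set i : 'I_D.+1 | mx_img (Es i) W != 0%VS]| = (D - r).+1.
Proof.
by rewrite -card_ord_geq; apply: eq_card => i; rewrite !inE level_neq0.
Qed.

Lemma chain_bottom : exists k, v = k *: chain u (D - r).
Proof. by have [k] := chain_W_proj r vW; rewrite Erv; exists k. Qed.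

(** Up to a nonzero scalar [v] is the last chain vector. The upward coefficients are nonzero, so the
    three-term relation can be solved for the higher vector, and one climbs back to [u]. *)
Lemma endpoint_cyclic Z : stable A Z -> v \in Z -> (W <= Z)%VS.
Proof.
move=> AZ vZ; have [k def_v] := chain_bottom.
have k0 : k != 0 by apply: contra v_neq0 => /eqP k0; rewrite def_v k0 scale0r.
have bZ : chain u (D - r) \in Z.
  by rewrite -[chain _ _]scale1r -(mulVf k0) -scalerA -def_v memvZ.
have out : chain u (D - r).+1 = 0.
  by apply/eqP; rewrite -[_ == 0]negbK chain_neq0 ltnn.
have allZ j : (j <= D - r)%N ->
    chain u (D - r - j) \in Z /\ chain u (D - r - j).+1 \in Z.
  elim: j => [|j IH] jr; first by rewrite subn0 out mem0v.
  have [] := IH (ltnW jr); rewrite (_ : D - r - j = (D - r - j.+1).+1)%N.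
    2: by rewrite subnS prednK // subn_gt0.
  move=> c1 c2; split=> //.
  have [z Az] := chain_three_term (D - r - j.+1).+1.
  have z0 : z != 0.
    apply: chain_coef_neq0 Az _.
    by rewrite chain_neq0 subnS prednK ?leq_subr // subn_gt0.
  rewrite -[chain _ _]scale1r -(mulVf z0) -scalerA memvZ //.
  by rewrite -[z *: _](addKr (chain u (D - r - j.+1).+2)) -Az memvD ?memvN ?AZ.
rewrite -chain_span0; apply/subv_sumP => i _; rewrite -memvE.
have [ir|ri] := leqP i (D - r).
  by have [] := allZ (D - r - i)%N (leq_subr _ _); rewrite subKn.
have /eqP -> : chain u i == 0 by rewrite -[_ == 0]negbK chain_neq0 -ltnNge.
exact: mem0v.
Qed.

(** Supplies the third eigenvector of A*. On the lowest level A only raises; raising once and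
    lowering again multiplies [v] by the coefficient [z] of the three-term relation, and subtracting
    [z *: v] leaves level r + 2. *)
Lemma endpoint_second : (r + 2 <= D)%N ->
  exists y', Esx (r%:Z + 2) *m (A *m (A *m v) - y' *: v)
             = A *m (A *m v) - y' *: v.
Proof.
move=> rD; have [k def_v] := chain_bottom.
have out : chain u (D - r).+1 = 0.
  by apply/eqP; rewrite -[_ == 0]negbK chain_neq0 ltnn.
have [m e] : exists m, (D - r = m.+2)%N by exists (D - r - 2)%N; lia.
rewrite e in out def_v.
have [z Az] := chain_three_term m.+2; have [z' Az'] := chain_three_term m.+1.
rewrite out add0r /= in Az; rewrite /= in Az'.
exists z; rewrite def_v.
have -> : A *m (A *m (k *: chain u m.+2)) - z *: (k *: chain u m.+2)
    = (k * z * z') *: chain u m.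
  rewrite -!scalemxAr Az -!scalemxAr Az'.
  by apply/colP => i; rewrite ![in LHS]mxE ![in RHS]mxE; ring.
rewrite -scalemxAr; congr (_ *: _); rewrite chain_proj ifT //; lia.
Qed.

End Chain.

Lemma endpoint_structure (r : 'I_D.+1) (v : 'cV_n) : (0 < r)%N ->
  (forall i : 'I_D.+1, (i < r)%N -> forall w, w \in W -> Es i *m w = 0) ->
  v \in W -> v != 0 -> Es r *m v = v ->
  [/\ #|[set i : 'I_D.+1 | mx_img (Es i) W != 0%VS]| = (D - r).+1,
      \dim W = (D - r).+1,
      forall Z, stable A Z -> v \in Z -> (W <= Z)%VS
    & (r + 2 <= D)%N -> exists y, Esx (r%:Z + 2) *m (A *m (A *m v) - y *: v)
                                  = A *m (A *m v) - y *: v].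
Proof.
move=> r0 below0 vW v0 Erv; have [u [f [y [uW u0 Eu Fu Ku]]]] := top_vector.
have bot0 w : w \in W -> Esx 0 *m w = 0.
  by move=> wW; have := idem_ext_ord Es ord0; rewrite /= => ->; exact: below0.
split.
- exact: (diameter_irreducible uW u0 Eu Fu Ku bot0 vW v0 Erv below0).
- exact: (dim_irreducible uW u0 Eu Fu Ku bot0 vW v0 Erv below0).
- exact: (endpoint_cyclic uW u0 Eu Fu Ku bot0 vW v0 Erv below0).
- exact: (endpoint_second uW u0 Eu Fu Ku bot0 vW v0 Erv below0).
Qed.

End System.

(** * Solving for the dual intersection numbers *)

Section DualNumbers.
Variables (F : fieldType) (D r t d : nat) (q s h hs c : F).
Variables (cs as_ bs : nat -> F) (x : F).
Local Notation th := (eigval q s h).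
Local Notation tau := (dual_eigval D q hs c).
Hypothesis rd : (r + d)%N = D.
Hypothesis td : (t + d <= D)%N.
Hypothesis q_neq0 : q != 0.
Hypothesis h_neq0 : h != 0.
Hypothesis q_root : forall k, (0 < k <= 2 * D)%N -> q ^+ k != 1.
Hypothesis sq_root : forall k, (1 < k <= 2 * D)%N -> s * q ^+ k != 1.
Hypothesis cs0 : cs 0%N = 0.
Hypothesis bsd : bs d = 0.
(** The three rows are the components along E_{t+i} v of the statements that v, A v and A^2 v - x v
    are eigenvectors of A*. *)
Hypothesis row0 : forall i, (i <= d)%N -> cs i + as_ i + bs i = tau r.
Hypothesis row1 : forall i, (i <= d)%N -> (0 < d)%N ->
  cs i * th (t%:Z + i%:Z - 1) + as_ i * th (t%:Z + i%:Z)
  + bs i * th (t%:Z + i%:Z + 1) = tau (r%:Z + 1) * th (t%:Z + i%:Z).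
Hypothesis row2 : forall i, (i <= d)%N -> (1 < d)%N ->
  cs i * (th (t%:Z + i%:Z - 1) ^+ 2 - x) + as_ i * (th (t%:Z + i%:Z) ^+ 2 - x)
  + bs i * (th (t%:Z + i%:Z + 1) ^+ 2 - x)
  = tau (r%:Z + 2) * (th (t%:Z + i%:Z) ^+ 2 - x).

Let b := q ^+ r.
Let e := q ^+ d.
Let T := q ^+ t.

Let b_neq0 : b != 0. Proof. exact: expf_neq0. Qed.
Let e_neq0 : e != 0. Proof. exact: expf_neq0. Qed.
Let T_neq0 : T != 0. Proof. exact: expf_neq0. Qed.

Let expr_double k : q ^+ (2 * k) = (q ^+ k) ^+ 2.
Proof. by rewrite mulnC exprM. Qed.

Let expD : q ^+ (2 * D + 1) = (b * e) ^+ 2 * q.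
Proof. by rewrite -rd exprD mulnC exprM exprD. Qed.

(** Only differences of dual eigenvalues enter the solution; they are free of the additive constant
    [c], and D = r + d turns them into expressions in q^r and q^d. *)
Let tau_diff1 :
  tau (r%:Z + 1) - tau r = hs * (1 - q) * (e ^+ 2 - 1) / (b * e ^+ 2 * q).
Proof.
rewrite /dual_eigval expD !expfzDr // expr1z -exprnP -/b; field.
by rewrite q_neq0 b_neq0 e_neq0.
Qed.

Let tau_diff2 : tau (r%:Z + 2) - tau r
  = hs * (1 - q ^+ 2) * (e ^+ 2 * q^-1 - 1) / (b * e ^+ 2 * q).
Proof.
rewrite /dual_eigval expD !expfzDr // -!exprnP -/b; field.
by rewrite q_neq0 b_neq0 e_neq0.
Qed.

Let thE (i : nat) : th (t%:Z + i%:Z)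
  = h / (T * q ^+ i) + h * s * q * (T * q ^+ i).
Proof. by rewrite /eigval -PoszD -exprnP exprD. Qed.

Let thS (i : nat) : th (t%:Z + i%:Z + 1)
  = h / (T * q ^+ i * q) + h * s * q * (T * q ^+ i * q).
Proof. by rewrite /eigval -!PoszD -exprnP !exprD expr1. Qed.

Let thP (i : nat) : th (t%:Z + i%:Z - 1)
  = h / (T * q ^+ i / q) + h * s * q * (T * q ^+ i / q).
Proof.
by rewrite /eigval -PoszD expfzDr // -exprnP exprD exprN1.
Qed.

Let sub1_neq0 k : (0 < k <= 2 * D)%N -> 1 - q ^+ k != 0.
Proof. by move=> kD; rewrite subr_eq0 eq_sym q_root. Qed.

Let sub1s_neq0 k : (1 < k <= 2 * D)%N -> 1 - s * q ^+ k != 0.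
Proof. by move=> kD; rewrite subr_eq0 eq_sym sq_root. Qed.

(** At i = 0 the term in [cs] drops out, and [row0] with [row1] determines [bs 0]: its coefficient
    theta_{t+1} - theta_t is nonzero. *)
Lemma dual_b0 : bs 0%N = hs * (q ^+ (2 * d) - 1) * (1 + s * q ^+ (2 * t + 1))
  / (q ^+ (D + d) * (1 - s * q ^+ (2 + 2 * t))).
Proof.
have [d0|d_gt0] := posnP d.
  by move: bsd; rewrite d0 muln0 subrr mulr0 !mul0r.
have := row1 (leq0n d) d_gt0; have := row0 (leq0n d).
rewrite cs0 mul0r !add0r => /(canRL (addrK _)) ->.
move/eqP; rewrite -subr_eq0 => /eqP r1.
have s0 : 1 - s * q ^+ (2 + 2 * t) != 0 by apply: sub1s_neq0; lia.
have q0 : 1 - q != 0 by have := @sub1_neq0 1; rewrite expr1; apply; lia.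
have q1 : q ^+ (2 + 2 * t) = (q * T) ^+ 2.
  by rewrite exprMn exprD [(2 * t)%N]mulnC exprM.
have q2 : q ^+ (2 * t + 1) = T ^+ 2 * q by rewrite exprD mulnC exprM.
have q3 : q ^+ (2 * d) = e ^+ 2 by rewrite mulnC exprM.
have q4 : q ^+ (D + d) = b * e * e by rewrite -rd !exprD.
rewrite q1 in s0; rewrite q1 q2 q3 q4.
have K0 : th (t%:Z + 0%N%:Z + 1) - th (t%:Z + 0%N%:Z) != 0.
  have -> : th (t%:Z + 0%N%:Z + 1) - th (t%:Z + 0%N%:Z)
     = h * (1 - q) * (1 - s * (q * T) ^+ 2) / (T * q).
    by rewrite thE thS; field; rewrite q_neq0 T_neq0.
  by rewrite !mulf_neq0 // invr_neq0 // mulf_neq0.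
apply: (mulIf K0).
transitivity ((tau (r%:Z + 1) - tau r) * th (t%:Z + 0%N%:Z)).
  by apply/eqP; rewrite -subr_eq0; apply/eqP; rewrite -r1; ring.
rewrite tau_diff1 thE thS.
by field; rewrite q_neq0 T_neq0 b_neq0 e_neq0 s0.
Qed.

(** The mirror case i = d: here [bs] drops out and the coefficient is theta_{t+d-1} -
    theta_{t+d}. *)
Lemma dual_cd : cs d = hs * (1 - q ^+ (2 * d))
    * (1 + s * q ^+ (2 * t + 2 * d + 1))
  / (q ^+ (D + d + 1) * (1 - s * q ^+ (2 * t + 2 * d))).
Proof.
have [d0|d_gt0] := posnP d.
  by rewrite d0 muln0 subrr mulr0 !mul0r.
have := row1 (leqnn d) d_gt0; have := row0 (leqnn d).
rewrite bsd mul0r !addr0 addrC => /(canRL (addrK _)) ->.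
move/eqP; rewrite -subr_eq0 => /eqP r1.
have s0 : 1 - s * q ^+ (2 * t + 2 * d) != 0 by apply: sub1s_neq0; lia.
have q0 : 1 - q != 0 by have := @sub1_neq0 1; rewrite expr1; apply; lia.
have q1 : q ^+ (2 * t + 2 * d) = (T * e) ^+ 2.
  by rewrite exprMn exprD !expr_double.
have q3 : q ^+ (2 * d) = e ^+ 2 by rewrite mulnC exprM.
have q4 : q ^+ (D + d + 1) = b * e * e * q by rewrite -rd !exprD.
rewrite q1 in s0; rewrite [q ^+ (_ + 1)]exprD q1 q3 q4.
have K0 : th (t%:Z + d%:Z - 1) - th (t%:Z + d%:Z) != 0.
  have -> : th (t%:Z + d%:Z - 1) - th (t%:Z + d%:Z)
     = - h * (1 - q) * (1 - s * (T * e) ^+ 2) / (T * e).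
    by rewrite thE thP -/e; field; rewrite q_neq0 T_neq0 e_neq0.
  by rewrite !mulf_neq0 ?oppr_eq0 // invr_neq0 // mulf_neq0.
apply: (mulIf K0).
transitivity ((tau (r%:Z + 1) - tau r) * th (t%:Z + d%:Z)).
  by apply/eqP; rewrite -subr_eq0; apply/eqP; rewrite -r1; ring.
rewrite tau_diff1 thE thP -/e.
by field; rewrite q_neq0 T_neq0 b_neq0 e_neq0 s0.
Qed.

Section Middle.
Variable i : nat.
Hypothesis i_in : (1 <= i <= d - 1)%N.

Let I_neq0 : q ^+ i != 0. Proof. exact: expf_neq0. Qed.

(* Eliminating [x] between the rows [0] and [i] leaves two linear equations for
   [cs i] and [bs i]. *)
Let middle_rows :
  let Q := tau (r%:Z + 2) - tau r in let P := tau (r%:Z + 1) - tau r in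
  let th0 := th (t%:Z + 0%N%:Z) in let thi := th (t%:Z + i%:Z) in
  let thm := th (t%:Z + i%:Z - 1) in let thp := th (t%:Z + i%:Z + 1) in
  let S := Q * (thi ^+ 2 - th0 ^+ 2)
           + P * th0 * (th (t%:Z + 0%N%:Z + 1) + th0) in
  bs i * ((thp - thm) * (thp - thi)) = S - P * thi * (thm + thi) /\
  cs i * ((thm - thp) * (thm - thi)) = S - P * thi * (thp + thi).
Proof.
have d1 : (1 < d)%N by lia.
have id : (i <= d)%N by lia.
have := row2 (leq0n d) d1; have := row1 (leq0n d) (ltnW d1).
have := row0 (leq0n d); rewrite cs0 !mul0r !add0r => /(canRL (addrK _)) ->.
have := row2 id d1; have := row1 id (ltnW d1).
have := row0 id; rewrite addrAC addrC => /(canRL (addrK _)) ->.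
move=> r1 r2 r10 r20 /=.
(* Subtracting [thm + thi] times [row1] from [row2] removes [cs i], and [thp + thi] removes [bs i]
   instead; for index 0 the multiplier is [th1 + th0]. The difference of the two results no longer
   contains [x]. *)
have comb (X1 X2 Y1 Y2 Z1 Z2 W1 W2 u w : F) :
    X1 = Z1 -> X2 = Z2 -> Y1 = W1 -> Y2 = W2 ->
    0 = X2 - Z2 - u * (X1 - Z1) - (Y2 - W2 - w * (Y1 - W1)).
  by move=> -> -> -> ->; ring.
set th0 := th (t%:Z + 0%N%:Z) in r10 r20 *.
set th1 := th (t%:Z + 0%N%:Z + 1) in r10 r20 *.
set thi := th (t%:Z + i%:Z) in r1 r2 *.
set thm := th (t%:Z + i%:Z - 1) in r1 r2 *.
set thp := th (t%:Z + i%:Z + 1) in r1 r2 *.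
split; apply/eqP; rewrite -subr_eq0; apply/eqP.
  by rewrite (comb _ _ _ _ _ _ _ _ (thm + thi) (th1 + th0) r1 r2 r10 r20); ring.
by rewrite (comb _ _ _ _ _ _ _ _ (thp + thi) (th1 + th0) r1 r2 r10 r20); ring.
Qed.

Let I := q ^+ i.
Let expTI k : q ^+ (2 * i + 2 * t + k) = q ^+ k * (T * I) ^+ 2.
Proof. by rewrite exprMn 2!exprD !expr_double -/T -/I; ring. Qed.

Let TI0 : 1 - s * (T * I) ^+ 2 != 0.
Proof.
by have := @sub1s_neq0 (2 * i + 2 * t + 0); rewrite expTI mul1r; apply; lia.
Qed.
Let TI1 : 1 - s * (q * (T * I) ^+ 2) != 0.
Proof.
by have := @sub1s_neq0 (2 * i + 2 * t + 1); rewrite expTI expr1; apply; lia.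
Qed.
Let TI2 : 1 - s * (q * (T * I)) ^+ 2 != 0.
Proof.
by have := @sub1s_neq0 (2 * i + 2 * t + 2); rewrite expTI -exprMn; apply; lia.
Qed.
Let q1 : 1 - q != 0.
Proof. by have := @sub1_neq0 1; rewrite expr1; apply; lia. Qed.
Let q2 : 1 - q ^+ 2 != 0.
Proof. by apply: sub1_neq0; clear - rd i_in; lia. Qed.
Lemma dual_bi : bs i = hs * (q ^ ((2 * d)%:Z - (2 * i)%:Z) - 1)
    * (1 - s ^+ 2 * q ^+ (2 + 2 * i + 4 * t))
  / (q ^ ((D + d)%:Z - (2 * i)%:Z) * (1 - s * q ^+ (2 + 2 * i + 2 * t))
     * (1 - s * q ^+ (1 + 2 * i + 2 * t))).
Proof.
have -> : (2 + 2 * i + 2 * t = 2 * i + 2 * t + 2)%N by rewrite -addnA addnC.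
have -> : (1 + 2 * i + 2 * t = 2 * i + 2 * t + 1)%N by rewrite -addnA addnC.
rewrite !expTI expr1.
have -> : q ^+ (2 + 2 * i + 4 * t) = q ^+ 2 * I ^+ 2 * T ^+ 4.
  by rewrite 2!exprD expr_double [(4 * t)%N]mulnC exprM.
have -> : q ^ ((2 * d)%:Z - (2 * i)%:Z) = e ^+ 2 / I ^+ 2.
  by rewrite expfzDr // -invr_expz -!exprnP !expr_double.
have -> : q ^ ((D + d)%:Z - (2 * i)%:Z) = b * e * e / I ^+ 2.
  rewrite expfzDr // -invr_expz -!exprnP -rd 2!exprD expr_double.
  by [].
have [bsE _] := middle_rows.
(* The coefficient of [bs i] is a product of nonzero factors: h, 1 - q, 1 - q^2, and 1 - s q^k for k
   = 2i + 2t + 1 and k = 2i + 2t + 2. *)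
have K0 : (th (t%:Z + i%:Z + 1) - th (t%:Z + i%:Z - 1))
    * (th (t%:Z + i%:Z + 1) - th (t%:Z + i%:Z)) != 0.
  have -> : (th (t%:Z + i%:Z + 1) - th (t%:Z + i%:Z - 1))
    * (th (t%:Z + i%:Z + 1) - th (t%:Z + i%:Z))
    = h ^+ 2 * (1 - q ^+ 2) * (1 - s * (q * (T * I) ^+ 2)) * (1 - q)
      * (1 - s * (q * (T * I)) ^+ 2) / (T * I * q) ^+ 2.
    by rewrite thE thS thP -/I; field; rewrite q_neq0 T_neq0 I_neq0.
  by rewrite !mulf_neq0 ?invr_neq0 ?expf_neq0 ?mulf_neq0.
apply: (mulIf K0); rewrite bsE /= tau_diff1 tau_diff2 !thE !thS thP.
rewrite expr0 -/I mulr1.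
by field; rewrite I_neq0 T_neq0 q_neq0 TI1 TI2 e_neq0 b_neq0.
Qed.

Lemma dual_ci : cs i = hs * (1 - q ^+ (2 * i))
    * (1 - s ^+ 2 * q ^+ (2 + 2 * d + 4 * t + 2 * i))
  / (q ^+ (D + d + 1) * (1 - s * q ^+ (2 * i + 2 * t))
     * (1 - s * q ^+ (1 + 2 * i + 2 * t))).
Proof.
have -> : (1 + 2 * i + 2 * t = 2 * i + 2 * t + 1)%N by rewrite -addnA addnC.
rewrite -[X in s * q ^+ X]addn0 !expTI expr1 expr0 mul1r.
have -> : q ^+ (2 + 2 * d + 4 * t + 2 * i) = q ^+ 2 * e ^+ 2 * T ^+ 4 * I ^+ 2.
  by rewrite 3!exprD !expr_double [(4 * t)%N]mulnC exprM.
have -> : q ^+ (2 * i) = I ^+ 2 by rewrite expr_double.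
have -> : q ^+ (D + d + 1) = b * e * e * q by rewrite -rd 3!exprD.
have [_ csE] := middle_rows.
have K0 : (th (t%:Z + i%:Z - 1) - th (t%:Z + i%:Z + 1))
    * (th (t%:Z + i%:Z - 1) - th (t%:Z + i%:Z)) != 0.
  have -> : (th (t%:Z + i%:Z - 1) - th (t%:Z + i%:Z + 1))
    * (th (t%:Z + i%:Z - 1) - th (t%:Z + i%:Z))
    = h ^+ 2 * (1 - q ^+ 2) * (1 - s * (q * (T * I) ^+ 2)) * (1 - q)
      * (1 - s * (T * I) ^+ 2) / ((T * I) ^+ 2 * q).
    by rewrite thE thS thP -/I; field; rewrite q_neq0 T_neq0 I_neq0.
  by rewrite !mulf_neq0 ?invr_neq0 ?mulf_neq0 ?expf_neq0.
apply: (mulIf K0); rewrite csE /= tau_diff1 tau_diff2 !thE !thS thP.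
rewrite expr0 -/I mulr1.
by field; rewrite I_neq0 T_neq0 q_neq0 TI1 TI0 e_neq0 b_neq0.
Qed.

End Middle.
End DualNumbers.

(** * The vectors E_i v of a cyclic v in an irreducible module *)

Section Support.
Variables (C : numClosedFieldType) (X : finType) (D : nat).
Local Notation n := #|X|.
Variables (A As : 'M[C]_n) (E Es : 'I_D.+1 -> 'M[C]_n).
Variables (theta thetas : 'I_D.+1 -> C).
Hypothesis resE : resolution E.
Hypothesis resEs : resolution Es.
Hypothesis AE : forall i, A *m E i = theta i *: E i.
Hypothesis AsEs : forall i, As *m Es i = thetas i *: Es i.
Hypothesis theta_inj : injective theta.
Hypothesis thetas_inj : injective thetas.
Hypothesis EAsE : forall i j : 'I_D.+1, (i.+1 < j)%N || (j.+1 < i)%N ->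
  E i *m As *m E j = 0.
Variable W : {vspace 'cV[C]_n}.
Hypothesis AW : stable A W.
Hypothesis EsW : forall i, stable (Es i) W.
Hypothesis W_irr : forall U, stable A U -> (forall i, stable (Es i) U) ->
  (U <= W)%VS -> U = 0%VS \/ U = W.
Variables (v : 'cV[C]_n) (t : 'I_D.+1) (d : nat).
Hypothesis vW : v \in W.
Hypothesis v_cyclic : forall Z, stable A Z -> v \in Z -> (W <= Z)%VS.
Hypothesis EtW : exists2 w, w \in W & E t *m w != 0.
Hypothesis below0 : forall i : 'I_D.+1, (i < t)%N ->
  forall w, w \in W -> E i *m w = 0.
Hypothesis dimW : \dim W = d.+1.
Local Notation Ex := (idem_ext E).

Let EW i : stable (E i) W.
Proof. exact: (stable_resolution resE AE). Qed.

Let Ev_proj i : E i *m (E i *m v) = E i *m v.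
Proof. by rewrite resolution_mul ?eqxx. Qed.

(** The span of the [E i *m v] is stable under A and contains [v], so cyclicity makes it W; in
    particular each E_i W is at most a line. *)
Let spanW : (\sum_i <[E i *m v]>)%VS = W.
Proof.
apply/eqP; rewrite eqEsubv; apply/andP; split.
  by apply/subv_sumP => i _; rewrite -memvE EW.
apply: v_cyclic; last first.
  rewrite {1}(resolution_sum resE v); apply: memv_suml => i _.
  by rewrite memvE (sumv_sup i).
move=> w /memv_sumP[us usP ->]; rewrite mulmx_sumr; apply: memv_suml => i _.
have /vlineP[k ->] := usP i isT.
rewrite -scalemxAr mulmxA AE -scalemxAl !memvZ //.
by rewrite memvE (sumv_sup i).
Qed.

Let span_below (k : nat) : {vspace 'cV[C]_n} :=
  (\sum_(i < D.+1 | (i < k)%N) <[E i *m v]>)%VS.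

Let mem_below k (i : 'I_D.+1) : (i < k)%N -> E i *m v \in span_below k.
Proof. by move=> ik; rewrite memvE /span_below (sumv_sup i). Qed.

Let in_line i w : w \in W -> exists k, E i *m w = k *: (E i *m v).
Proof. by rewrite -spanW => /(graded_proj resE _ Ev_proj)/vlineP. Qed.

Let Et_neq0 : E t *m v != 0.
Proof.
have [w wW] := EtW; have [k ->] := in_line t wW.
by apply: contra => /eqP ->; rewrite scaler0.
Qed.

(** A* moves E-levels by at most one, so a zero at [k] makes the span of the lower [E i *m v] stable
    under A* as well as under A. It is nonzero because of level [t], hence it is all of W. *)
Let gap (k : 'I_D.+1) : (t < k)%N -> E k *m v = 0 ->
  forall l : 'I_D.+1, (k <= l)%N -> E l *m v = 0.
Proof.
move=> tk Ek0 l kl.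
have belowE i : stable (E i) (span_below k).
  move=> w /memv_sumP[us usP ->]; rewrite mulmx_sumr; apply: memv_suml => j jk.
  have /vlineP[z ->] := usP j jk; rewrite -scalemxAr memvZ //.
  by rewrite resolution_mul //; case: eqP => [->|]; rewrite ?mem0v ?mem_below.
have belowAs : stable As (span_below k).
  move=> w /memv_sumP[us usP ->]; rewrite mulmx_sumr; apply: memv_suml => j jk.
  have /vlineP[z ->] := usP j jk; rewrite -scalemxAr memvZ //.
  have AsvW : As *m (E j *m v) \in W.
    by apply: (stable_As resEs AsEs EsW); exact: EW.
  rewrite (resolution_sum resE (As *m _)); apply: memv_suml => i _.
  have [ik|ki] := ltnP i k.
    by have [y ->] := in_line i AsvW; rewrite memvZ ?mem_below.
  have [/val_inj <-|nik] := eqVneq (k : nat) i.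
    by have [y ->] := in_line k AsvW; rewrite Ek0 scaler0 mem0v.
  rewrite !mulmxA EAsE ?mul0mx ?mem0v //.
  by rewrite orbC; apply/orP; left; move: nik jk ki; lia.
have [||U0|UW] := W_irr (stable_A resE AE belowE) _ _.
- exact: (stable_resolution resEs AsEs thetas_inj belowAs).
- by apply/subv_sumP => i _; rewrite -memvE EW.
- by move: (mem_below tk); rewrite U0 memv0 (negPf Et_neq0).
have : E l *m v \in span_below k by rewrite UW EW.
move=> /memv_sumP[us usP def]; rewrite -Ev_proj def mulmx_sumr big1 // => j jk.
have /vlineP[z ->] := usP j jk; rewrite -scalemxAr resolution_mul //.
by case: eqP jk => [<-|]; rewrite ?scaler0 // ltnNge kl.
Qed.

Lemma dual_support (k : int) :
  (Ex k *m v != 0) = (t%:Z <= k) && (k <= t%:Z + d%:Z).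
Proof.
(* The minimal such index is the first one above [t] where the vector vanishes, or D + 1. The
   support is the interval from [t] up to it, and the dimension of W gives its length. *)
pose P k := (t < k)%N && ((D < k)%N || (Ex k%:Z *m v == 0)).
have exP : exists k, P k by exists D.+1; rewrite /P ltnSn andbT ltn_ord.
case: (ex_minnP exP) => m /andP[tm Pm] m_min.
have mD : (m <= D.+1)%N by apply: m_min; rewrite /P ltnSn andbT ltn_ord.
have Sm (j : 'I_D.+1) : (E j *m v != 0) = (t <= j < m)%N.
  have [jt|tj] := ltnP j t; first by rewrite below0 ?eqxx.
  have [jm|mj] /= := ltnP j m; last first.
    have mD' : (m < D.+1)%N by apply: leq_ltn_trans mj (ltn_ord j).
    have Em0 : E (Ordinal mD') *m v = 0.
      move: Pm; rewrite ltnNge -ltnS mD' /= => /eqP <-.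
      by rewrite -(idem_ext_ord E (Ordinal mD')).
    by rewrite (gap _ Em0) ?eqxx.
  have [/val_inj <- //|ntj] := eqVneq (t : nat) j.
  apply/negP => Ej0; have := m_min j; rewrite /P idem_ext_ord Ej0 orbT.
  by rewrite ltn_neqAle ntj tj leqNgt jm => /(_ isT).
have card : (m - t = d.+1)%N.
  rewrite -dimW -spanW (dim_graded resE Ev_proj) -sum1dep_card.
  rewrite (eq_bigl _ _ Sm) -(big_mkord (fun j => (t <= j < m)%N) (fun=> 1%N)).
  rewrite -[LHS]muln1 -sum_nat_const_nat.
  rewrite (@big_nat_widen _ _ _ t m D.+1) // (@big_nat_widenl _ _ _ t 0%N) //.
  by apply: eq_bigl => j; rewrite andbC.
case: idem_extP => [i ->|out].
  by rewrite Sm; lia.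
by rewrite mul0mx eqxx; have := ltn_ord t; lia.
Qed.

End Support.

(** * The primary module and the theorem *)

Local Arguments idem_ext : simpl never.

Section DualRows.
Variables (C : fieldType) (X : finType) (D : nat) (x : X).
Local Notation n := #|X|.
Variable E : 'I_D.+1 -> 'M[C]_n.
Hypothesis resE : resolution E.
Local Notation As := (dual_assoc_mx x E).
Local Notation Ex := (idem_ext E).

Lemma dual_raising_ext k (v : 'cV_n) :
  dual_raising x E *m (Ex k *m v) = Ex (k + 1) *m (As *m (Ex k *m v)).
Proof.
rewrite mulmx_suml; case: (idem_extP E k) => [i ->|_]; last first.
  by rewrite mul0mx !mulmx0 big1 // => i _; rewrite mulmx0.
rewrite (bigD1 i) //= big1 ?addr0 => [|j ji].
  by rewrite -!mulmxA resolution_mul // eqxx.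
by rewrite -!mulmxA resolution_mul // (negPf ji) !mulmx0.
Qed.

Lemma dual_flat_ext k (v : 'cV_n) :
  dual_flat x E *m (Ex k *m v) = Ex k *m (As *m (Ex k *m v)).
Proof.
rewrite mulmx_suml; case: (idem_extP E k) => [i _|_]; last first.
  by rewrite mul0mx !mulmx0 big1 // => i _; rewrite mulmx0.
rewrite (bigD1 i) //= big1 ?addr0 => [|j ji].
  by rewrite -!mulmxA resolution_mul // eqxx.
by rewrite -!mulmxA resolution_mul // (negPf ji) !mulmx0.
Qed.

Lemma dual_lowering_ext k (v : 'cV_n) :
  dual_lowering x E *m (Ex k *m v) = Ex (k - 1) *m (As *m (Ex k *m v)).
Proof.
rewrite mulmx_suml; case: (idem_extP E k) => [i ->|_]; last first.
  by rewrite mul0mx !mulmx0 big1 // => i _; rewrite mulmx0.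
rewrite (bigD1 i) //= big1 ?addr0 => [|j ji].
  by rewrite -!mulmxA resolution_mul // eqxx.
by rewrite -!mulmxA resolution_mul // (negPf ji) !mulmx0.
Qed.

Hypothesis EAsE : forall i j : 'I_D.+1, (i.+1 < j)%N || (j.+1 < i)%N ->
  E i *m As *m E j = 0.
Variables (v : 'cV[C]_n) (k : int) (a b c : C).
Hypothesis vk : Ex k *m v != 0.
Hypothesis lowE : Ex k *m (As *m (Ex (k - 1) *m v)) = c *: (Ex k *m v).
Hypothesis flatE : Ex k *m (As *m (Ex k *m v)) = a *: (Ex k *m v).
Hypothesis highE : Ex k *m (As *m (Ex (k + 1) *m v)) = b *: (Ex k *m v).

(** This is the component at [k] of [As *m z = mu *: z]. It will be used with [p] equal to 1, theta
    and theta^2 - y, for z = v, A v and A^2 v - y v. *)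
Lemma dual_row (p : int -> C) (mu : C) (z : 'cV_n) :
  (forall l, Ex l *m z = p l *: (Ex l *m v)) -> As *m z = mu *: z ->
  c * p (k - 1) + a * p k + b * p (k + 1) = mu * p k.
Proof.
move=> zE Asz; have := congr1 (mulmx (Ex k)) Asz.
rewrite (tridiag_row resE EAsE) !zE -!scalemxAr lowE flatE highE !zE !scalerA.
rewrite -!scalerDl => /eqP; rewrite -subr_eq0 -scalerBl scaler_eq0 (negPf vk).
by rewrite orbF subr_eq0 => /eqP <-; ring.
Qed.

End DualRows.

(** * Nondegeneracy of q and s, and the primary module *)

Section Setting.
Variables (C : numClosedFieldType) (X : finType) (D : nat).
Variables (Y : sym_scheme X D) (E : 'I_D.+1 -> 'M[C]_#|X|).
Variables (theta thetas : 'I_D.+1 -> C) (x : X) (q s h hs : C).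
Variable kr : 'I_D.+1 -> 'I_D.+1 -> 'I_D.+1 -> C.
Local Notation n := #|X|.
Local Notation assoc := (assoc_mx C Y).
Local Notation A := (assoc (inord 1)).
Local Notation As := (dual_assoc_mx x E).
Local Notation Es := (dual_idem C Y x).
Local Notation Ex := (idem_ext E).
Local Notation Esx := (idem_ext Es).
Local Notation ex := (delta_mx (enum_rank x) 0 : 'cV[C]_n).
Hypothesis D_ge3 : (3 <= D)%N.
Hypothesis Ppoly : P_polynomial Y.
Hypothesis abip : almost_bipartite Y.
Hypothesis Eprim : primitive_idempotents Y E.
Hypothesis krP : krein_parameters E kr.
Hypothesis krT : triangular kr.
Hypothesis AE : forall i, A *m E i = theta i *: E i.
Hypothesis AsEs : forall i, As *m Es i = thetas i *: Es i.
Hypothesis q_neq0 : q != 0.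
Hypothesis h_neq0 : h != 0.
Hypothesis hs_neq0 : hs != 0.
Hypothesis theta_form : forall i : 'I_D.+1,
  theta i = theta ord0 + h * (1 - q ^+ i) * (1 - s * q ^+ i.+1) * q ^- i.
Hypothesis thetas_form : forall i : 'I_D.+1,
  thetas i = thetas ord0
    + hs * (1 - q ^+ i) * (1 - q ^ (- (2 * D)%:Z - 1 + i%:Z)) * q ^- i.

Let D_gt0 : (0 < D)%N. Proof. exact: leq_trans D_ge3. Qed.
Let resE : resolution E := idem_resolution Eprim.
Let resEs : resolution Es := dual_idem_resolution C Y x.
Let EAsE := idem_dual_assoc_far Ppoly D_gt0 Eprim AE krP krT x.
Let EsAEs (i j : 'I_D.+1) := @dual_idem_adj_far C X D Y Ppoly D_gt0 x i j.
Let th_inj : injective theta := theta_inj Ppoly D_gt0 Eprim AE.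
Let ths_inj : injective thetas := thetas_inj Ppoly D_gt0 Eprim krP krT AsEs.

Lemma dual_idem_flat (i : 'I_D.+1) : (i < D)%N -> Es i *m A *m Es i = 0.
Proof. by move=> iD; rewrite dual_idem_adj //; exact: abip.1. Qed.

(** [cst] and [off] are the additive constants left when theta*_i and theta_i are written through
    q^i and q^-i; [off] is shown to vanish below. *)
Let cst := thetas ord0 - hs * (1 + (q ^+ (2 * D + 1))^-1).
Let off := theta ord0 - h * (1 + s * q).

Lemma thetas_closed (i : 'I_D.+1) :
  thetas i = cst + hs * (q ^- i + q ^+ i / q ^+ (2 * D + 1)).
Proof.
rewrite thetas_form /cst.
have -> : q ^ (- (2 * D)%:Z - 1 + i%:Z) = q ^+ i / q ^+ (2 * D + 1).
  rewrite expfzDr // -opprD -invr_expz mulrC -exprnP; congr (_ * _^-1).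
have Q0 := expf_neq0 (2 * D + 1) q_neq0; have i0 := expf_neq0 i q_neq0.
by move: (q ^+ (2 * D + 1)) (q ^+ i) Q0 i0 => Q a Q0 a0; field; rewrite Q0 a0.
Qed.

Lemma theta_closed_off (i : 'I_D.+1) :
  theta i = off + (h * q ^- i + h * s * q * q ^+ i).
Proof.
rewrite theta_form /off exprS; have i0 := expf_neq0 i q_neq0.
by move: (q ^+ i) i0 => a a0; field.
Qed.

(** If q^k = 1, then theta*_k = theta*_0 when k is at most D, and theta*_{2D+1-k} = theta*_0
    otherwise, against injectivity. *)
Lemma q_root k : (0 < k <= 2 * D)%N -> q ^+ k != 1.
Proof.
move=> /andP[k0 kD]; apply/eqP => qk.
have bad (i : 'I_D.+1) : (0 < i)%N -> thetas i = thetas ord0 -> False.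
  by move=> i0 /ths_inj e; rewrite e in i0.
have [kleD|Dk] := leqP k D.
  have kD1 : (k < D.+1)%N by [].
  apply: (bad (Ordinal kD1)) => //.
  by rewrite thetas_form /= qk subrr mulr0 !mul0r addr0.
have iD : (2 * D + 1 - k < D.+1)%N by lia.
apply: (bad (Ordinal iD)) => /=; first by lia.
rewrite thetas_form /=.
have -> : - (2 * D)%:Z - 1 + (2 * D + 1 - k)%N%:Z = - k%:Z by lia.
by rewrite -invr_expz -exprnP qk invr1 subrr mulr0 mul0r addr0.
Qed.

Lemma sq_root k : (1 < k <= 2 * D)%N -> s * q ^+ k != 1.
Proof.
move=> /andP[k1 kD]; apply/eqP => sqk.
(* Every k from 2 to 2D is i + j + 1 with distinct i, j in [0, D], and s q^(i+j+1) = 1 forces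
   theta_i = theta_j. *)
pose i := minn k.-1 D; pose j := (k.-1 - i)%N.
have [iD jD] : (i < D.+1)%N /\ (j < D.+1)%N by rewrite /i /j; lia.
have ij : i != j by rewrite /i /j; lia.
have def_k : k = (i + j).+1 by rewrite /i /j; lia.
suff /th_inj/(congr1 val)/eqP : theta (Ordinal iD) = theta (Ordinal jD).
  by rewrite /= (negPf ij).
rewrite !theta_closed_off /=; congr (off + _).
move: sqk; rewrite def_k exprS exprD.
have := expf_neq0 i q_neq0; have := expf_neq0 j q_neq0.
move: (q ^+ i) (q ^+ j) => a b b0 a0 sqk.
have sq : s * q = (a * b)^-1.
  by apply: (mulIf (mulf_neq0 a0 b0)); rewrite mulVf ?mulf_neq0 // -mulrA.
by rewrite -!mulrA !(mulrA s) sq; field; rewrite a0 b0.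
Qed.

Let Es_ex k : Esx k *m ex = if k == 0 then ex else 0.
Proof.
have e0 : Esx 0 *m ex = ex.
  have := dual_idem_vertex C Y x ord0; rewrite assoc0 mul1mx.
  by rewrite -idem_ext_ord.
by rewrite -{1}e0 (idem_ext_mul resEs); case: eqP => // ->; rewrite e0.
Qed.

Let Es_assoc k (i : 'I_D.+1) :
  Esx k *m (assoc i *m ex) = if k == i%:Z then assoc i *m ex else 0.
Proof.
rewrite -{1}(dual_idem_vertex C Y x i) -idem_ext_ord (idem_ext_mul resEs).
by case: eqP => // ->; rewrite idem_ext_ord dual_idem_vertex.
Qed.

Let Es_Aex k : Esx k *m (A *m ex) = if k == 1 then A *m ex else 0.
Proof. by rewrite Es_assoc val_inord1. Qed.

Let As_Es k (w : 'cV_n) :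
  As *m (Esx k *m w) = dual_eigval D q hs cst k *: (Esx k *m w).
Proof. exact: (AsEsx AsEs thetas_closed). Qed.

Let Es_As k (w : 'cV_n) :
  Esx k *m (As *m w) = dual_eigval D q hs cst k *: (Esx k *m w).
Proof. exact: (EsxAs resEs AsEs thetas_closed). Qed.

Lemma second_vertex_neq0 : Esx 2 *m (A *m (A *m ex)) != 0.
Proof.
have two : (inord 2 : 'I_D.+1) = 2 :> nat by rewrite inordK //; lia.
rewrite mulmxA mulmxA -(mulmxA _ A A) (assoc_mul C Y) mulmx_sumr mulmx_suml.
rewrite (bigD1 (inord 2)) //= big1 ?addr0 => [|i i2].
  rewrite -scalemxAr -scalemxAl -mulmxA Es_assoc two eqxx scaler_eq0 negb_or.
  rewrite (assoc_vertex_neq0 _ Ppoly) andbT pnatr_eq0.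
  by apply: (triangular_near Ppoly); left; rewrite two val_inord1.
rewrite -scalemxAr -scalemxAl -mulmxA Es_assoc ifF ?scaler0 //.
by apply: contraNF i2 => /eqP[e]; apply/eqP/val_inj; rewrite /= two.
Qed.

(** The matrix A - off satisfies the tridiagonal relation. A has no flat part on levels 0, 1, 2, so
    by parity only words with exactly two letters A lead from [ex] to level 2, and each carries one
    factor [off]. The total coefficient is off (theta*_0 - theta*_2)(q + 1/q - 2). *)
Lemma offset_eq0 : off = 0.
Proof.
pose B : 'M_n := A - off%:M.
have BE w : B *m w = A *m w - off *: w :> 'cV_n.
  by rewrite mulmxBl mul_scalar_mx.
have BEi i : B *m E i = (h * q ^- i + h * s * q * q ^+ i) *: E i.
  rewrite mulmxBl mul_scalar_mx AE theta_closed_off -scalerBl.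
  by congr (_ *: _); ring.
have := tridiagonal_relation resE BEi EAsE q_neq0 (fun=> erefl) ex.
move=> /(congr1 (mulmx (Esx 2))).
set g1 := A *m ex; set g2 := Esx 2 *m (A *m g1); set z := Esx 0 *m (A *m g1).
have Ag1 : A *m g1 = z + g2.
  have := tridiag_col resEs EsAEs 1 g1; rewrite Es_Aex /=.
  rewrite (_ : Esx 1 *m (A *m g1) = 0) ?addr0 //.
  rewrite -{1}[g1](_ : Esx 1 *m g1 = g1); last by rewrite Es_Aex.
  by rewrite (Esx_flat dual_idem_flat) //; lia.
have t0 : As *m ex = dual_eigval D q hs cst 0 *: ex.
  by have := As_Es 0 ex; rewrite Es_ex.
have t1 : As *m g1 = dual_eigval D q hs cst 1 *: g1.
  by have := As_Es 1 g1; rewrite Es_Aex.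
have tz : As *m z = dual_eigval D q hs cst 0 *: z by exact: As_Es.
have t2 : As *m g2 = dual_eigval D q hs cst 2 *: g2 by exact: As_Es.
have Pex : Esx 2 *m ex = 0 by rewrite Es_ex.
have Pg1 : Esx 2 *m g1 = 0 by rewrite Es_Aex.
have Pz : Esx 2 *m z = 0 by rewrite (idem_ext_mul resEs).
have Pg2 : Esx 2 *m g2 = g2 by rewrite (idem_extK resEs).
have PAz : Esx 2 *m (A *m z) = 0 by rewrite (tridiag_far EsAEs).
have PAg2 : Esx 2 *m (A *m g2) = 0.
  by rewrite (Esx_flat dual_idem_flat) //; lia.
rewrite !(BE, mulmxDr, mulmxN, =^~ scalemxAr, Es_As, t0, t1, tz, t2, Ag1).
rewrite -/g1.
rewrite !(BE, mulmxDr, mulmxN, =^~ scalemxAr, Es_As, t0, t1, tz, t2, Ag1,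
  Pex, Pg1, Pz, Pg2, PAz, PAg2).
rewrite !(scaler0, addr0, add0r, oppr0).
set tau0 := dual_eigval _ _ _ _ 0; set tau1 := dual_eigval _ _ _ _ 1.
set tau2 := dual_eigval _ _ _ _ 2 => eq0.
have : (off * (tau0 - tau2) * (q + q^-1 - 2)) *: g2 = 0.
  by rewrite -eq0; apply/colP => i; rewrite !mxE; ring.
move/eqP; rewrite scaler_eq0 (negPf second_vertex_neq0) orbF !mulf_eq0.
move=> /orP[/orP[/eqP //|]|].
  have two : (2 < D.+1)%N by lia.
  have -> : tau0 = thetas ord0 by rewrite thetas_closed.
  have -> : tau2 = thetas (Ordinal two) by rewrite thetas_closed.
  by rewrite subr_eq0 => /eqP/ths_inj.
have -> : q + q^-1 - 2 = (q - 1) ^+ 2 / q by field.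
have q1 : q != 1 by have := @q_root 1; rewrite expr1; apply; lia.
by rewrite mulf_eq0 invr_eq0 (negPf q_neq0) orbF expf_eq0 subr_eq0 (negPf q1).
Qed.

Lemma theta_closed (i : 'I_D.+1) : theta i = h * q ^- i + h * s * q * q ^+ i.
Proof. by rewrite theta_closed_off offset_eq0 add0r. Qed.

(** The dual intersection numbers of the primary module: the Krein parameters q^i_{1,i-1},
    q^i_{1,i}, q^i_{1,i+1}, with value 0 where an index would leave [0, D]. *)
Let cs0 i := if i is i'.+1 then kr (inord i) (inord 1) (inord i') else 0.
Let as0 i := kr (inord i) (inord 1) (inord i).
Let bs0 i := if (i < D)%N then kr (inord i) (inord 1) (inord i.+1) else 0.

Let Ex_As_ex (k : nat) (j : 'I_D.+1) : (k <= D)%N ->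
  Ex k *m (As *m (E j *m ex)) = kr (inord k) (inord 1) j *: (Ex k *m ex).
Proof.
move=> kD; rewrite (dual_assoc_vertex Eprim krP) mulmx_sumr.
have -> : Ex k = E (inord k) by rewrite -idem_ext_ord inordK.
rewrite (bigD1 (inord k)) //= big1 ?addr0 => [|i ik].
  by rewrite -scalemxAr resolution_mul // eqxx.
by rewrite -scalemxAr resolution_mul // eq_sym (negPf ik) scaler0.
Qed.

Let Ex_in (k : nat) : (k <= D)%N -> Ex k = E (inord k).
Proof. by move=> kD; rewrite -idem_ext_ord inordK. Qed.

Let vertex_row (i : nat) (p : int -> C) (mu : C) (z : 'cV_n) : (i <= D)%N ->
  (forall l, Ex l *m z = p l *: (Ex l *m ex)) -> As *m z = mu *: z ->
  cs0 i * p (i%:Z - 1) + as0 i * p i%:Z + bs0 i * p (i%:Z + 1) = mu * p i%:Z.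
Proof.
move=> iD; apply: (dual_row resE EAsE).
- by rewrite Ex_in // (vertex_idem_neq0 Ppoly Eprim).
- case: i iD => [|i] iD /=.
    rewrite scale0r (_ : Ex (0%N%:Z - 1) = 0) ?mul0mx ?mulmx0 //.
  rewrite (_ : i.+1%:Z - 1 = i); last by lia.
  by rewrite (Ex_in (ltnW iD)) Ex_As_ex.
- by rewrite {2}Ex_in // Ex_As_ex.
- rewrite /bs0; case: ltnP => Di.
    rewrite (_ : i%:Z + 1 = i.+1); last by lia.
    by rewrite (Ex_in Di) Ex_As_ex.
  rewrite scale0r (_ : Ex (i%:Z + 1) = 0) ?mul0mx ?mulmx0 //.
  by case: idem_extP => // l; have := ltn_ord l; lia.
Qed.

Let th_eig k (w : 'cV_n) : Ex k *m (A *m w) = eigval q s h k *: (Ex k *m w).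
Proof. exact: (ExA resE AE theta_closed). Qed.

Lemma vertex_second :
  exists y, Esx 2 *m (A *m (A *m ex) - y *: ex) = A *m (A *m ex) - y *: ex.
Proof.
(* The scalar is the diagonal entry of A^2 at [x], that is, the component of A^2 [ex] on level 0;
   the component on level 1 is zero. *)
set y := (A *m (A *m ex)) (enum_rank x) 0.
have flat : Esx 1 *m (A *m (A *m ex)) = 0.
  rewrite -{1}[A *m ex](_ : Esx 1 *m (A *m ex) = _); last by rewrite Es_Aex.
  by rewrite (Esx_flat dual_idem_flat) //; lia.
have := tridiag_col resEs EsAEs 1 (A *m ex); rewrite Es_Aex /= flat addr0.
rewrite (_ : 1 - 1 = 0%N%:Z) // (idem_ext_ord _ ord0) dual_idem0 -/y => e.
exists y; have -> : A *m (A *m ex) - y *: ex = Esx 2 *m (A *m (A *m ex)).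
  by rewrite {1}e addrAC subrr add0r.
by rewrite (idem_extK resEs).
Qed.

(** The rows of the primary module are stated in the shape required for r = t = 0 and d = D. *)
Let vertex_row0 i : (i <= D)%N ->
  cs0 i + as0 i + bs0 i = dual_eigval D q hs cst 0%N%:Z.
Proof.
move=> iD; have := @vertex_row i (fun=> 1) (dual_eigval D q hs cst 0) ex iD.
rewrite !mulr1; apply=> [l|]; first by rewrite scale1r.
by have := As_Es 0 ex; rewrite Es_ex.
Qed.

Let vertex_row1 i : (i <= D)%N -> (0 < D)%N ->
  cs0 i * eigval q s h (0%N%:Z + i%:Z - 1)
  + as0 i * eigval q s h (0%N%:Z + i%:Z)
  + bs0 i * eigval q s h (0%N%:Z + i%:Z + 1)
  = dual_eigval D q hs cst (0%N%:Z + 1) * eigval q s h (0%N%:Z + i%:Z).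
Proof.
move=> iD _; rewrite !add0r.
apply: (@vertex_row i (eigval q s h) _ (A *m ex)) => //.
by have := As_Es 1 (A *m ex); rewrite Es_Aex.
Qed.

Let vertex_row2 y : Esx 2 *m (A *m (A *m ex) - y *: ex)
    = A *m (A *m ex) - y *: ex ->
  forall i, (i <= D)%N -> (1 < D)%N ->
  cs0 i * (eigval q s h (0%N%:Z + i%:Z - 1) ^+ 2 - y)
  + as0 i * (eigval q s h (0%N%:Z + i%:Z) ^+ 2 - y)
  + bs0 i * (eigval q s h (0%N%:Z + i%:Z + 1) ^+ 2 - y)
  = dual_eigval D q hs cst (0%N%:Z + 2)
    * (eigval q s h (0%N%:Z + i%:Z) ^+ 2 - y).
Proof.
move=> Ey i iD _; rewrite !add0r.
apply: (@vertex_row i (fun l => eigval q s h l ^+ 2 - y) _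
  (A *m (A *m ex) - y *: ex)) => // [l|].
  rewrite mulmxBr !th_eig -scalemxAr scalerA -scalerBl; congr (_ *: _).
by rewrite -{1}Ey As_Es Ey.
Qed.

(** Equality would give theta_{D-i} = - theta_i, so the eigenvalues would sum to 0; by [trace_theta]
    their sum is p^D_{1D}. *)
Let trace_neq0 : s * q ^+ D.+1 != -1.
Proof.
apply/negP => /eqP sqD.
have : \sum_i theta i = (isnum Y ord_max (inord 1) ord_max)%:R.
  rewrite (trace_theta Ppoly Eprim AE).
  rewrite (bigD1 ord_max) //= big1 ?addr0 // => i iD.
  rewrite abip.1 //.
  rewrite ltn_neqAle -ltnS ltn_ord andbT.
  by apply: contra iD => /eqP e; apply/eqP/val_inj.
have opp_th (i : 'I_D.+1) : theta (rev_ord i) = - theta i.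
  rewrite !theta_closed /= subSS.
  have iD : (i <= D)%N by rewrite -ltnS.
  have e : q ^+ D = q ^+ (D - i) * q ^+ i by rewrite -exprD subnK.
  move: sqD; rewrite exprS e.
  have := expf_neq0 (D - i) q_neq0; have := expf_neq0 i q_neq0.
  move: (q ^+ (D - i)) (q ^+ i) => a b b0 a0 sqab.
  have sq : s * q = - (a * b)^-1.
    apply: (mulIf (mulf_neq0 a0 b0)).
    by rewrite mulNr mulVf ?mulf_neq0 // -sqab; ring.
  by rewrite -!mulrA !(mulrA s) sq; field; rewrite a0 b0.
have -> : \sum_i theta i = 0.
  apply/eqP; rewrite -eqNr -sumrN eq_sym (reindex_inj rev_ord_inj) /=.
  by apply/eqP; apply: eq_bigr => i _.
by move=> /esym/eqP; rewrite pnatr_eq0 => /eqP; exact: abip.2.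
Qed.

Let bs0_neq0 i : (i < D)%N -> bs0 i != 0.
Proof.
move=> iD; rewrite /bs0 iD; apply: (triangular_near krT); right; right.
by rewrite val_inord1 ?inordK ?addn1 //; lia.
Qed.

Let cs0_neq0 i : (0 < i <= D)%N -> cs0 i != 0.
Proof.
case: i => // i iD; apply: (triangular_near krT); left.
by rewrite val_inord1 ?inordK ?add1n //; lia.
Qed.

(** Except at k = D + 1, each k is matched with a nonzero Krein parameter whose closed form would
    vanish: k = 1 with b*_0, 2 to D with b*_{k-1}, D + 2 to 2D with c*_{k-1-D}, and 2D + 1 with
    c*_D. *)
Lemma sq_neq k : (0 < k <= 2 * D + 1)%N -> s * q ^+ k != -1.
Proof.
move=> /andP[k0 kD]; have [y Ey] := vertex_second.
have DD : (0 + D)%N = D by []. have DD' : (0 + D <= D)%N by [].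
have bsD : bs0 D = 0 by rewrite /bs0 ltnn.
have sq2 : s * q ^+ k = -1 -> 1 - s ^+ 2 * q ^+ (2 * k) = 0.
  by rewrite mulnC exprM -exprMn => ->; rewrite sqrrN expr1n subrr.
have [->|k1] := eqVneq k 1%N.
  apply/eqP => sq1; have := bs0_neq0 D_gt0.
  rewrite (dual_b0 DD DD' q_neq0 h_neq0 q_root sq_root _ bsD vertex_row0
             vertex_row1) //.
  by rewrite muln0 add0n sq1 subrr mulr0 mul0r eqxx.
have [kleD|Dk] := leqP k D.
  apply/eqP => /sq2 sqk; have i_in : (1 <= k.-1 <= D - 1)%N by lia.
  have /bs0_neq0 : (k.-1 < D)%N by lia.
  rewrite (dual_bi DD DD' q_neq0 h_neq0 q_root sq_root _ vertex_row0 vertex_row1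
             (vertex_row2 Ey) i_in) //.
  rewrite (_ : (2 + 2 * k.-1 + 4 * 0 = 2 * k)%N); last by lia.
  by rewrite sqk mulr0 mul0r eqxx.
have [->|kD1] := eqVneq k D.+1; first exact: trace_neq0.
have [->|kD2] := eqVneq k (2 * D + 1)%N.
  apply/eqP => sqk; have /cs0_neq0 : (0 < D <= D)%N by rewrite D_gt0 /=.
  rewrite (dual_cd DD DD' q_neq0 h_neq0 q_root sq_root _ bsD vertex_row0
             vertex_row1) //.
  by rewrite muln0 add0n sqk subrr mulr0 mul0r eqxx.
apply/eqP => /sq2 sqk; pose i := (k - 1 - D)%N.
have i_in : (1 <= i <= D - 1)%N by rewrite /i; lia.
have /cs0_neq0 : (0 < i <= D)%N by lia.
rewrite (dual_ci DD DD' q_neq0 h_neq0 q_root sq_root _ vertex_row0 vertex_row1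
           (vertex_row2 Ey) i_in) //.
rewrite (_ : (2 + 2 * D + 4 * 0 + 2 * i = 2 * k)%N); last by rewrite /i; lia.
by rewrite sqk mulr0 mul0r eqxx.
Qed.

(** * An arbitrary irreducible module and its dual intersection numbers *)

Section Module.
Variables (W : {vspace 'cV[C]_n}) (r t : 'I_D.+1) (d : nat).
Variables (cs as_ bs : nat -> C).
Hypothesis W_irr : irreducible_T_module Y x W.
Hypothesis W_end : endpoint Y x W r.
Hypothesis W_dual : dual_endpoint E W t.
Hypothesis W_diam : diameter Y x W d.
Hypothesis W_num : dual_intersection_numbers Y x E W r t d cs as_ bs.

Let WT : T_module Y x W. Proof. by case: W_irr. Qed.
Let W_neq0 : W <> 0%VS. Proof. by case: W_irr. Qed.
Let AW : stable A W. Proof. exact: (T_module_adj WT). Qed.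
Let EsW i : stable (Es i) W. Proof. exact: (T_module_dual_idem WT). Qed.

Let W_min U : stable A U -> (forall i, stable (Es i) U) -> (U <= W)%VS ->
  U = 0%VS \/ U = W.
Proof.
move=> AU EsU; case: W_irr => _ _; apply.
apply: (T_module_of_stable Eprim) => //.
exact: (stable_resolution resE AE).
Qed.

Let below0 (i : 'I_D.+1) : (i < r)%N -> forall w, w \in W -> Es i *m w = 0.
Proof. by move=> ir; apply/mx_img_eq0P; exact: W_end.2. Qed.

Let dual_below0 (i : 'I_D.+1) : (i < t)%N -> forall w, w \in W -> E i *m w = 0.
Proof. by move=> it; apply/mx_img_eq0P; exact: W_dual.2. Qed.

Variable v : 'cV[C]_n.
Hypothesis vW : v \in W.
Hypothesis v_neq0 : v != 0.
Hypothesis Erv : Es r *m v = v.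

(** E*_0 projects onto the line of [ex], so W contains [ex]. By the Krein identity the span of the
    E_i [ex] is stable under A*, as it is under A, hence equals W; all E_i [ex] and A_i [ex] are
    nonzero, which gives dimension and diameter. *)
Let vertex_module : r = ord0 ->
  [/\ (r + d)%N = D, \dim W = d.+1,
    forall Z, stable A Z -> v \in Z -> (W <= Z)%VS
  & exists y, Esx (r%:Z + 2) *m (A *m (A *m v) - y *: v)
              = A *m (A *m v) - y *: v].
Proof.
move=> r0.
have def_v : v = v (enum_rank x) 0 *: ex by rewrite -(dual_idem0 Y) -r0 Erv.
set k := v _ _ in def_v.
have k0 : k != 0 by apply: contra v_neq0 => /eqP k0; rewrite def_v k0 scale0r.
have exZ (Z : {vspace 'cV[C]_n}) : v \in Z -> ex \in Z.
  by move=> vZ; rewrite -[ex]scale1r -(mulVf k0) -scalerA -def_v memvZ.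
pose S : {vspace 'cV[C]_n} := (\sum_i <[E i *m ex]>)%VS.
have Ein i : E i *m ex \in S by rewrite memvE (sumv_sup i).
have ES i : stable (E i) S.
  move=> w /memv_sumP[us usP ->]; rewrite mulmx_sumr; apply: memv_suml => j _.
  have /vlineP[z ->] := usP j isT; rewrite -scalemxAr memvZ //.
  by rewrite resolution_mul //; case: eqP => _; rewrite ?mem0v ?Ein.
have AsS : stable As S.
  move=> w /memv_sumP[us usP ->]; rewrite mulmx_sumr; apply: memv_suml => j _.
  have /vlineP[z ->] := usP j isT; rewrite -scalemxAr memvZ //.
  rewrite (dual_assoc_vertex Eprim krP); apply: memv_suml => l _.
  by rewrite memvZ.
have subS (Z : {vspace 'cV[C]_n}) : stable A Z -> v \in Z -> (S <= Z)%VS.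
  move=> AZ /exZ eZ; apply/subv_sumP => i _; rewrite -memvE.
  exact: (stable_resolution resE AE).
have SW : S = W.
  have [|S0|//] := W_min (stable_A resE AE ES) _ (subS W AW vW).
    exact: (stable_resolution resEs AsEs).
  have := Ein ord0; rewrite S0 memv0.
  by rewrite (negPf (vertex_idem_neq0 Ppoly Eprim x ord0)).
have dimW : \dim W = D.+1.
  rewrite -SW (dim_graded resE) => [|i]; last by rewrite resolution_mul ?eqxx.
  rewrite (eq_card (B := 'I_D.+1)) ?card_ord // => i.
  by rewrite inE (vertex_idem_neq0 Ppoly Eprim).
have dD : d = D.
  apply: succn_inj; rewrite -W_diam (eq_card (B := 'I_D.+1)) ?card_ord // => i.
  rewrite inE; apply/eqP => /mx_img_eq0P/(_ (assoc i *m ex)) Es0.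
  move/negP: (assoc_vertex_neq0 C Ppoly x i); apply; apply/eqP.
  rewrite -dual_idem_vertex Es0 //; apply: WT; last exact: exZ.
  by apply: Terw_M; exact: assoc_in.
split; rewrite ?dD ?r0 //; first by move=> Z AZ vZ; rewrite -SW subS.
have [y Ey] := vertex_second; exists y.
rewrite (_ : ord0%:Z + 2 = 2) // def_v -!scalemxAr scalerA mulrC -scalerA.
by rewrite -scalerBr -scalemxAr Ey.
Qed.

Lemma endpoint_vector :
  [/\ (r + d)%N = D, \dim W = d.+1,
    forall Z, stable A Z -> v \in Z -> (W <= Z)%VS
  & (1 < d)%N -> exists y, Esx (r%:Z + 2) *m (A *m (A *m v) - y *: v)
                            = A *m (A *m v) - y *: v].
Proof.
have [r0|rn0] := eqVneq r ord0.
  by have [? ? ? ?] := vertex_module r0; split.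
have r_gt0 : (0 < r)%N by rewrite lt0n.
have D_gt2 : (2 < D)%N by [].
have [card dimW cyc second] :=
  endpoint_structure resE resEs AE AsEs th_inj ths_inj EAsE EsAEs dual_idem_flat
    q_neq0 hs_neq0 theta_closed thetas_closed q_root h_neq0 sq_neq D_gt2 AW EsW
    W_neq0 W_min r_gt0 below0 vW v_neq0 Erv.
have dE : d = (D - r)%N by apply: succn_inj; rewrite -W_diam.
have rD : (r <= D)%N by rewrite -ltnS.
split=> //; rewrite ?dE ?subnKC // => d1.
by apply: second; move: d1; rewrite ltn_subRL addn1 -addn2.
Qed.

Lemma module_numbers :
  [/\ cs 0%N = 0,
      forall i : nat, (1 <= i <= d - 1)%N ->
        cs i = hs * (1 - q ^+ (2 * i))
                  * (1 - s ^+ 2 * q ^+ (2 + 2 * d + 4 * t + 2 * i))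
               / (q ^+ (D + d + 1) * (1 - s * q ^+ (2 * i + 2 * t))
                  * (1 - s * q ^+ (1 + 2 * i + 2 * t)))
    & cs d = hs * (1 - q ^+ (2 * d)) * (1 + s * q ^+ (2 * t + 2 * d + 1))
             / (q ^+ (D + d + 1) * (1 - s * q ^+ (2 * t + 2 * d)))] /\
  [/\ bs 0%N = hs * (q ^+ (2 * d) - 1) * (1 + s * q ^+ (2 * t + 1))
               / (q ^+ (D + d) * (1 - s * q ^+ (2 + 2 * t))),
      forall i : nat, (1 <= i <= d - 1)%N ->
        bs i = hs * (q ^ ((2 * d)%:Z - (2 * i)%:Z) - 1)
                  * (1 - s ^+ 2 * q ^+ (2 + 2 * i + 4 * t))
               / (q ^ ((D + d)%:Z - (2 * i)%:Z)
                  * (1 - s * q ^+ (2 + 2 * i + 2 * t))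
                  * (1 - s * q ^+ (1 + 2 * i + 2 * t))),
      bs d = 0
    & forall i : nat, (i <= d)%N -> as_ i = thetas r - bs i - cs i].
Proof.
have [rd dimW cyc second] := endpoint_vector.
have supp k : (Ex k *m v != 0) = (t%:Z <= k) && (k <= t%:Z + d%:Z).
  apply: (dual_support resE resEs AE AsEs th_inj ths_inj EAsE AW EsW W_min vW
            cyc (mx_img_neq0 W_dual.1) dual_below0 dimW).
have v_num i : (i <= d)%N -> [/\
    Ex (t%:Z + i%:Z) *m (As *m (Ex (t%:Z + i%:Z - 1) *m v))
      = cs i *: (Ex (t%:Z + i%:Z) *m v),
    Ex (t%:Z + i%:Z) *m (As *m (Ex (t%:Z + i%:Z) *m v))
      = as_ i *: (Ex (t%:Z + i%:Z) *m v)
  & Ex (t%:Z + i%:Z) *m (As *m (Ex (t%:Z + i%:Z + 1) *m v))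
      = bs i *: (Ex (t%:Z + i%:Z) *m v)].
  move=> id; have vr : v \in mx_img (Es r) W by apply/mem_mx_imgP; exists v.
  have [] := W_num id vr v_neq0.
  rewrite (dual_raising_ext _ resE) (dual_flat_ext _ resE).
  by rewrite (dual_lowering_ext _ resE) !addrA subrK addrK.
have v_supp i : (i <= d)%N -> Ex (t%:Z + i%:Z) *m v != 0.
  by move=> id; rewrite supp; lia.
(* Outside the support E_k v = 0; this yields c*_0 = 0 and b*_d = 0 at the two ends. *)
have out k : ~~ ((t%:Z <= k) && (k <= t%:Z + d%:Z)) -> Ex k *m v = 0.
  by rewrite -supp negbK => /eqP.
have cs_0 : cs 0%N = 0.
  have [+ _ _] := v_num 0%N (leq0n d); rewrite out; last by lia.
  rewrite !mulmx0 => /esym/eqP.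
  by rewrite scaler_eq0 (negPf (v_supp 0%N (leq0n d))) orbF => /eqP.
have bs_d : bs d = 0.
  have [_ _] := v_num d (leqnn d); rewrite out; last by lia.
  rewrite !mulmx0 => /esym/eqP.
  by rewrite scaler_eq0 (negPf (v_supp d (leqnn d))) orbF => /eqP.
have td : (t + d <= D)%N.
  have := v_supp d (leqnn d).
  by case: idem_extP => [i e|_]; [have := ltn_ord i; lia|rewrite mul0mx eqxx].
have row (p : int -> C) (mu : C) (z : 'cV_n) :
    (forall l, Ex l *m z = p l *: (Ex l *m v)) -> As *m z = mu *: z ->
    forall i, (i <= d)%N ->
    cs i * p (t%:Z + i%:Z - 1) + as_ i * p (t%:Z + i%:Z)
    + bs i * p (t%:Z + i%:Z + 1) = mu * p (t%:Z + i%:Z).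
  move=> pz Asz i id; have [low flat high] := v_num i id.
  exact: (dual_row resE EAsE (v_supp i id) low flat high pz Asz).
have Esx_r : Esx r *m v = v by rewrite idem_ext_ord.
have Asv : As *m v = dual_eigval D q hs cst r *: v.
  by have := As_Es r v; rewrite Esx_r.
have row0 i : (i <= d)%N -> cs i + as_ i + bs i = dual_eigval D q hs cst r.
  move=> id; have := row (fun=> 1) _ v _ Asv i id.
  by rewrite !mulr1; apply=> l; rewrite scale1r.
(* Nothing of W lies below level r, and for d > 0 the level r is not D, so A has no flat part
   there. *)
have Av : (0 < d)%N -> Esx (r%:Z + 1) *m (A *m v) = A *m v.
  move=> d0; have := tridiag_col resEs EsAEs r v; rewrite Esx_r.
  rewrite (_ : Esx (r%:Z - 1) *m (A *m v) = 0) ?add0r; last first.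
    case: idem_extP => [i e|_]; last by rewrite mul0mx.
    by apply: (below0 _ (AW vW)); lia.
  have flat := Esx_flat dual_idem_flat (k := r%:Z) v.
  by rewrite -{2}Esx_r flat ?add0r //; lia.
have row1 i : (i <= d)%N -> (0 < d)%N ->
    cs i * eigval q s h (t%:Z + i%:Z - 1) + as_ i * eigval q s h (t%:Z + i%:Z)
    + bs i * eigval q s h (t%:Z + i%:Z + 1)
    = dual_eigval D q hs cst (r%:Z + 1) * eigval q s h (t%:Z + i%:Z).
  move=> id /Av EAv; apply: (row _ _ (A *m v)) => //.
  by have := As_Es (r%:Z + 1) (A *m v); rewrite EAv.
have [y row2] : exists y, forall i, (i <= d)%N -> (1 < d)%N ->
    cs i * (eigval q s h (t%:Z + i%:Z - 1) ^+ 2 - y)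
    + as_ i * (eigval q s h (t%:Z + i%:Z) ^+ 2 - y)
    + bs i * (eigval q s h (t%:Z + i%:Z + 1) ^+ 2 - y)
    = dual_eigval D q hs cst (r%:Z + 2) * (eigval q s h (t%:Z + i%:Z) ^+ 2 - y).
  (* For d at most 1 the third row is vacuous and any scalar serves as [y]. *)
  have [d_gt1|d_le1] := ltnP 1 d; last by exists 0 => i _; lia.
  have [y Ey] := second d_gt1; exists y => i id _.
  apply: (row (fun l => eigval q s h l ^+ 2 - y) _
            (A *m (A *m v) - y *: v)) => //.
    move=> l; rewrite mulmxBr !th_eig -scalemxAr scalerA -scalerBl.
    by congr (_ *: _).
  by rewrite -{1}Ey As_Es Ey.
have cdE := dual_cd rd td q_neq0 h_neq0 q_root sq_root cs_0 bs_d row0 row1.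
have b0E := dual_b0 rd td q_neq0 h_neq0 q_root sq_root cs_0 bs_d row0 row1.
have biE := dual_bi rd td q_neq0 h_neq0 q_root sq_root cs_0 row0 row1 row2.
have ciE := dual_ci rd td q_neq0 h_neq0 q_root sq_root cs_0 row0 row1 row2.
do ![split=> //] => i id.
rewrite thetas_closed; have := row0 i id; rewrite /dual_eigval => <-; ring.
Qed.

End Module.
End Setting.

Theorem theorem15p6 (R : realType) (X : finType) (D : nat)
    (Y : sym_scheme X D) (E : 'I_D.+1 -> 'M[complex R]_#|X|)
    (theta thetas : 'I_D.+1 -> complex R) (x : X) (q s h hs : complex R)
    (W : {vspace 'cV[complex R]_#|X|}) (r t : 'I_D.+1) (d : nat)
    (cs as_ bs : nat -> complex R) :
  (3 <= D)%N ->
  P_polynomial Y ->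
  almost_bipartite Y ->
  primitive_idempotents Y E ->
  Q_polynomial E ->
  (forall i, assoc_mx _ Y (inord 1) *m E i = theta i *: E i) ->
  (forall i, dual_assoc_mx x E *m dual_idem _ Y x i
             = thetas i *: dual_idem _ Y x i) ->
  ~ iso_distance_scheme Y (@odd_adj D) ->
  ~ iso_distance_scheme Y (@folded_adj (2 * D + 1)) ->
  q != 0 -> h != 0 -> hs != 0 ->
  (forall i : 'I_D.+1,
     theta i = theta ord0 + h * (1 - q ^+ i) * (1 - s * q ^+ i.+1) * q ^- i) ->
  (forall i : 'I_D.+1,
     thetas i = thetas ord0
       + hs * (1 - q ^+ i) * (1 - q ^ (- (2 * D)%:Z - 1 + i%:Z)) * q ^- i) ->
  irreducible_T_module Y x W ->
  endpoint Y x W r ->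
  dual_endpoint E W t ->
  diameter Y x W d ->
  dual_intersection_numbers Y x E W r t d cs as_ bs ->
  [/\ cs 0%N = 0,
      forall i : nat, (1 <= i <= d - 1)%N ->
        cs i = hs * (1 - q ^+ (2 * i))
                  * (1 - s ^+ 2 * q ^+ (2 + 2 * d + 4 * t + 2 * i))
               / (q ^+ (D + d + 1) * (1 - s * q ^+ (2 * i + 2 * t))
                  * (1 - s * q ^+ (1 + 2 * i + 2 * t)))
    & cs d = hs * (1 - q ^+ (2 * d)) * (1 + s * q ^+ (2 * t + 2 * d + 1))
             / (q ^+ (D + d + 1) * (1 - s * q ^+ (2 * t + 2 * d)))] /\
  [/\ bs 0%N = hs * (q ^+ (2 * d) - 1) * (1 + s * q ^+ (2 * t + 1))
               / (q ^+ (D + d) * (1 - s * q ^+ (2 + 2 * t))),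
      forall i : nat, (1 <= i <= d - 1)%N ->
        bs i = hs * (q ^ ((2 * d)%:Z - (2 * i)%:Z) - 1)
                  * (1 - s ^+ 2 * q ^+ (2 + 2 * i + 4 * t))
               / (q ^ ((D + d)%:Z - (2 * i)%:Z)
                  * (1 - s * q ^+ (2 + 2 * i + 2 * t))
                  * (1 - s * q ^+ (1 + 2 * i + 2 * t))),
      bs d = 0
    & forall i : nat, (i <= d)%N -> as_ i = thetas r - bs i - cs i].
Proof.
move=> D_ge3 Ppoly abip Eprim [kr krP krT] AE AsEs _ _ q0 h0 hs0 theta_form
  thetas_form W_irr W_end W_dual W_diam W_num.
have [w wW Ew] := mx_img_neq0 W_end.1.
have resEs := dual_idem_resolution (complex R) Y x.
apply: (module_numbers D_ge3 Ppoly abip Eprim krP krT AE AsEs q0 h0 hs0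
  theta_form thetas_form W_irr W_end W_dual W_diam W_num _ Ew).
  by apply: T_module_dual_idem wW; case: W_irr.
by rewrite resolution_mul // eqxx.
Qed.
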